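(* Let $\mathbb{T}$ be a time scale, $a,b\in\mathbb{T}$, $\mathbb{T}_\ast=[a,b]_{\mathbb{T}}$. Let $u(t)$ and $f(t)$ be nonnegative rd-continuous functions on $\mathbb{T}_\ast$ and $\mathbb{T}_\ast^\kappa$, respectively. Let $k(t,s)$ be a kernel satisfying condition (K) of the context, such that $k(t,s)$ and $k^{\Delta_1}(t,s)$ are nonnegative for every $t,s\in\mathbb{T}_\ast$ with $s\le t$ for which they are defined, and $k$ is not identically zero on $\mathbb{T}_\ast^\kappa\times\mathbb{T}_\ast^{\kappa^2}$. Let $\Phi\in C(\mathbb{R}^+_0,\mathbb{R}^+_0)$ be nondecreasing, subadditive and submultiplicative with $\Phi(x)>0$ for $x>0$, let $W\in C(\mathbb{R}^+_0,\mathbb{R}^+_0)$ be nondecreasing with $W(x)>0$ for $x>0$, and let $g\in S$. Suppose that $a(t)$ is a positive, rd-continuous and nondecreasing function on $\mathbb{T}_\ast$. If $$u(t)\le a(t)+\int_a^tf(s)g(u(s))\Delta s+\int_a^tf(s)W\left(\int_a^sk(s,\tau)\Phi(u(\tau))\Delta\tau\right)\Delta s$$ for $a\le\tau\le s\le t\le b$, $\tau,s,t\in\mathbb{T}_\ast$, then for all $t\in\mathbb{T}_\ast$ satisfying $$G(1)+\int_a^tf(\tau)\Delta\tau\in\operatorname{Dom}(G^{-1})$$ and $$\Psi(\bar\zeta)+\int_a^{\rho(t)}k(\rho(t),\tau)\Phi(q(\tau))\Phi\left(\int_a^\tau f(\theta)\Delta\theta\right)\Delta\tau\in\operatorname{Dom}(\Psi^{-1}),$$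 we have $$u(t)\le q(t)\max\{a(t),1\}+q(t)\int_a^tf(s)W\left[\Psi^{-1}\left(\Psi(\bar\zeta)+\int_a^sk(s,\tau)\Phi(q(\tau))\Phi\left(\int_a^\tau f(\theta)\Delta\theta\right)\Delta\tau\right)\right]\Delta s,$$ where $$\Psi(x)=\int_{x_0}^x\frac{1}{\Phi(W(s))}ds,\ x>0,\ x_0>0,\qquad G(x)=\int_\delta^x\frac{ds}{g(s)},\ x>0,\ \delta>0,$$ $$q(t)=G^{-1}\left(G(1)+\int_a^tf(\tau)\Delta\tau\right),\qquad \bar\zeta=\int_a^{\rho(b)}k(\rho(b),s)\Phi(q(s)\max\{a(s),1\})\Delta s,$$ and $G^{-1}$, $\Psi^{-1}$ are the inverse functions of $G$, $\Psi$.
   Context: $\mathbb{R}^+_0=[0,\infty)$. A time scale is a nonempty closed subset of $\mathbb{R}$; $[a,b]_{\mathbb{T}}=[a,b]\cap\mathbb{T}$; $\sigma(t)=\inf\{s\in\mathbb{T}:s>t\}$, $\rho(t)=\sup\{s\in\mathbb{T}:s<t\}$. A superscript $\kappa$ removes the maximum if it is left-scattered ($\rho(t)<t$); $\kappa^2$ means twice. $f^\Delta$ is the $\Delta$-derivative (for each $\varepsilon>0$, $|f(\sigma(t))-f(s)-f^\Delta(t)(\sigma(t)-s)|\le\varepsilon|\sigma(t)-s|$ near $t$). rd-continuous: continuous at right-dense points ($\sigma(t)=t$), with finite left limits at left-dense points ($\rho(t)=t$). $\int_c^d f\Delta t=F(d)-F(c)$ with $F^\Delta=f$. The function $a(t)$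 is distinct from the endpoint $a$. Condition (K): $k$ is a real function of two time-scale variables such that for each $t\in\mathbb{T}_\ast^\kappa$ with $t>a$: $k$ is continuous at $(t,t)$; $k(t,\cdot)$ is rd-continuous on $[a,\sigma(t)]$; and for each $\varepsilon>0$ there is a neighborhood $U$ of $t$, independent of $\tau\in[a,\sigma(t)]$, with $|k(\sigma(t),\tau)-k(s,\tau)-k^{\Delta_1}(t,\tau)(\sigma(t)-s)|\le\varepsilon|\sigma(t)-s|$ for all $s\in U$, where $k^{\Delta_1}$ is the $\Delta$-derivative of $k$ with respect to the first variable. Class $S$: a nondecreasing continuous function $g:\mathbb{R}^+_0\to\mathbb{R}^+_0$ belongs to $S$ if $g(x)>0$ for $x>0$ and $(1/z)g(x)\le g(x/z)$ for all $x\ge0$ and $z\ge1$. *)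

(* Defs.v *)
From Stdlib Require Import Reals ClassicalEpsilon.
From Coquelicot Require Import Coquelicot.

Open Scope R_scope.

Definition time_scale (T : R -> Prop) : Prop := (exists t, T t) /\ closed T.

Definition segment (T : R -> Prop) (c d : R) : R -> Prop :=
  fun t => T t /\ c <= t <= d.

(* With the usual conventions inf {} = sup T and sup {} = inf T: the forward
   jump of max T is max T and the backward jump of min T is min T. *)
Definition sigma (T : R -> Prop) (t : R) : R :=
  match Glb_Rbar (fun s => T s /\ t < s) with Finite r => r | _ => t end.

Definition rho (T : R -> Prop) (t : R) : R :=
  match Lub_Rbar (fun s => T s /\ s < t) with Finite r => r | _ => t end.

Definition kappa (T : R -> Prop) : R -> Prop :=
  fun t => T t /\ ~ ((forall s, T s -> s <= t) /\ rho T t < t).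

Definition is_delta_derive (T : R -> Prop) (h : R -> R) (t l : R) : Prop :=
  forall eps : posreal,
    within T (locally t) (fun s =>
      Rabs (h (sigma T t) - h s - l * (sigma T t - s))
        <= eps * Rabs (sigma T t - s)).

Definition ex_delta_derive (T : R -> Prop) (h : R -> R) (t : R) : Prop :=
  exists l, is_delta_derive T h t l.

Definition Delta_derive (T : R -> Prop) (h : R -> R) (t : R) : R :=
  epsilon (inhabits 0) (is_delta_derive T h t).

(* [h] is only looked at on the subset [D] of the time scale [T]; right-dense
   and left-dense refer to [T]. *)
Definition rd_continuous (T D : R -> Prop) (h : R -> R) : Prop :=
  forall t, D t ->
    (sigma T t = t -> filterlim h (within D (locally t)) (locally (h t))) /\
    (rho T t = t -> exists l : R,
       filterlim h (within (fun s => D s /\ s < t) (locally t)) (locally l)).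

(* The integral over [c, d] with c <= d, by antiderivatives.  [h d] must not
   matter: if d is left-dense, an rd-continuous [h] may jump there, and F would
   have no Delta-derivative equal to [h d] relative to the time scale [c, d].
   Hence F' = h is required on [c, d) and F is continuous at d. *)
Definition is_delta_int (T : R -> Prop) (h : R -> R) (c d v : R) : Prop :=
  exists F : R -> R,
    (forall t, segment T c d t -> t < d ->
       is_delta_derive (segment T c d) F t (h t)) /\
    filterlim F (within (segment T c d) (locally d)) (locally (F d)) /\
    v = F d - F c.

Definition Delta_int (T : R -> Prop) (h : R -> R) (c d : R) : R :=
  epsilon (inhabits 0) (is_delta_int T h c d).

(* [T] is the time scale on which the kernel lives, with minimum [a]. *)
Definition condition_K (T : R -> Prop) (a : R) (k : R -> R -> R) : Prop :=
  forall t, kappa T t -> a < t ->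
    filterlim (fun p : R * R => k (fst p) (snd p))
      (within (fun p : R * R => T (fst p) /\ T (snd p)) (locally (t, t)))
      (locally (k t t)) /\
    rd_continuous T (segment T a (sigma T t)) (k t) /\
    (forall eps : posreal, exists U : R -> Prop, locally t U /\
       forall tau, segment T a (sigma T t) tau ->
       forall s, T s -> U s ->
         Rabs (k (sigma T t) tau - k s tau
               - Delta_derive T (fun r => k r tau) t * (sigma T t - s))
           <= eps * Rabs (sigma T t - s)).

Definition nonneg_half : R -> Prop := fun x => 0 <= x.

(* Continuous nondecreasing self-maps of [0, oo) that are positive on (0, oo);
   values at negative arguments are irrelevant. *)
Definition gauge (h : R -> R) : Prop :=
  continuous_on nonneg_half h /\
  (forall x, 0 <= x -> 0 <= h x) /\
  (forall x y, 0 <= x -> x <= y -> h x <= h y) /\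
  (forall x, 0 < x -> 0 < h x).

Definition subadditive (h : R -> R) : Prop :=
  forall x y, 0 <= x -> 0 <= y -> h (x + y) <= h x + h y.

Definition submultiplicative (h : R -> R) : Prop :=
  forall x y, 0 <= x -> 0 <= y -> h (x * y) <= h x * h y.

Definition class_S (g : R -> R) : Prop :=
  gauge g /\ forall x z, 0 <= x -> 1 <= z -> (1 / z) * g x <= g (x / z).

(* Domain and value of the inverse of a function defined on (0, oo). *)
Definition dom_inv (H : R -> R) (y : R) : Prop := exists x, 0 < x /\ H x = y.

Definition inv_fun (H : R -> R) (y : R) : R :=
  epsilon (inhabits 0) (fun x => 0 < x /\ H x = y).

(* Main.v *)
Require Import Defs.
From Stdlib Require Import Reals Lra Classical ClassicalEpsilon.
From Coquelicot Require Import Coquelicot.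
(* From here on sigma is the forward jump, not a finite sum. *)
Import Defs.
Open Scope R_scope.

(** The estimate is reached in three steps, each a comparison of increments.

    Write F for the primitive of f, V(s) for the inner integral of k(s,r) Phi(u(r)),
    and X for the primitive of f W(V).

    - Fix t and put m = max(al t, 1) + X t. Since al and X are nondecreasing, u is
      bounded on [a,t] by m plus the integral of f g(u). Division by m >= 1 is absorbed
      by g because g is in S, so the Bihari argument for g gives u <= q (max(al,1) + X)
      ([class_S_gronwall]). Membership in S also gives g(x) <= x g(1) for x >= 1, so G
      is unbounded and q is defined everywhere ([class_S_dom_inv]).
    - V is nondecreasing, hence X <= F W(V). Subadditivity and submultiplicativity of
      Phi turn the first estimate into V <= zeta + integral of k h Phi(W(V)), where
      h = Phi(q) Phi(F).
    - The right-hand side R of this inequality is compared with the integral E of k h: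
      k is nonnegative and nondecreasing in its first argument, so an increment of R is
      at most Phi(W(B)) times the increment of E whenever B bounds R before the end of
      the step. Hence Psi(R) - Psi(zeta) <= E ([volterra_bihari]), and inverting Psi and
      inserting the bound on V in the first estimate finishes the proof.

    Both Bihari arguments are instances of one lemma, [bihari_comparison], which speaks of
    increments, in place of derivatives of integrals with a parameter. Condition (K)
    enters through the monotonicity of k, the regularity of its sections and a
    Lipschitz bound at right-dense points ([condition_K_volterra_kernel]).

    Delta-integrals are computed as Riemann integrals: an rd-continuous function extended
    to be constant on each gap of the time scale is regulated, its Riemann integral is an
    antiderivative, and antiderivatives are unique up to constants
    ([Delta_int_ts_int]). Order, linearity and additivity of the integral are then those
    of the Riemann integral. *)

(** * Induction on a time scale *)

Lemma filterlim_withinE (h : R -> R) (D : R -> Prop) (t l : R) :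
  filterlim h (within D (locally t)) (locally l) <->
  forall e, 0 < e -> exists d, 0 < d /\
    forall s, D s -> Rabs (s - t) < d -> Rabs (h s - l) < e.
Proof.
split.
- intros H e He.
  destruct (proj1 (filterlim_locally _ _) H (mkposreal e He)) as [d Hd].
  exists d; split; [apply cond_pos|]. intros s Ds Hs. exact (Hd s Hs Ds).
- intros H. apply filterlim_locally. intros [e He].
  destruct (H e He) as [d [Hd H']]. exists (mkposreal d Hd).
  intros s Hs Ds. exact (H' s Ds Hs).
Qed.

Lemma closed_accumulation (T : R -> Prop) (t : R) :
  closed T -> (forall e, 0 < e -> exists s, T s /\ Rabs (s - t) < e) -> T t.
Proof.
intros HT H. apply HT. intros [d Hd].
destruct (H d (cond_pos d)) as [s [Hs H1]]. exact (Hd s H1 Hs).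
Qed.

(** The supremum of the points of [c,d] where Q holds lies in T because T is closed; the
    left-limit hypothesis puts it in the set, and a step to the right is then impossible
    unless it is d. Taken with T the whole line this is induction on real intervals. *)
Lemma time_scale_induction (T Q : R -> Prop) (c d : R) :
  closed T -> T d -> c <= d -> Q c -> T c ->
  (forall t, T t -> c <= t < d -> Q t -> exists s, T s /\ t < s <= d /\ Q s) ->
  (forall t, T t -> c < t <= d ->
     (forall e, 0 < e -> exists s, T s /\ c <= s /\ t - e < s < t /\ Q s) -> Q t) ->
  Q d.
Proof.
intros HT Td cd Qc Tc Hright Hleft.
set (A := fun x => T x /\ c <= x <= d /\ Q x).
destruct (completeness A) as [m [Hub Hleast]].
{ exists d. intros x [_ [Hx _]]. lra. }
{ exists c. repeat split; trivial; lra. }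
assert (cm : c <= m) by (apply Hub; repeat split; trivial; lra).
assert (md : m <= d) by (apply Hleast; intros x [_ [Hx _]]; lra).
assert (Am : A m).
{ apply NNPP. intros nAm.
  assert (Hacc : forall e, 0 < e -> exists s, T s /\ c <= s /\ m - e < s < m /\ Q s).
  { intros e He. apply NNPP. intros Hn.
    assert (m <= m - e); [|lra].
    apply Hleast. intros x Ax. apply Rnot_lt_le. intros Hx. apply Hn.
    exists x. destruct Ax as [Tx [Hx1 Qx]]. repeat split; trivial; try lra.
    assert (Hxm : x <= m) by (apply Hub; repeat split; trivial; lra).
    destruct (Rle_lt_or_eq_dec _ _ Hxm) as [?|E]; trivial.
    exfalso. apply nAm. rewrite <- E. repeat split; trivial; lra. }
  assert (Tm : T m).
  { apply closed_accumulation; trivial. intros e He.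
    destruct (Hacc e He) as [s [Ts [_ [Hs _]]]]. exists s. split; trivial.
    apply Rabs_def1; lra. }
  apply nAm. repeat split; trivial; try lra.
  apply Hleft; trivial.
  destruct (Hacc 1 Rlt_0_1) as [s Hs]. lra. }
destruct Am as [Tm [_ Qm]].
destruct (Rle_lt_or_eq_dec _ _ md) as [Hlt|E]; [|now rewrite <- E].
exfalso. destruct (Hright m Tm (conj cm Hlt) Qm) as [s [Ts [Hs Qs]]].
assert (s <= m); [|lra]. apply Hub. repeat split; trivial; lra.
Qed.

(** * Dense and scattered points *)

(** Order-theoretic density: unlike [sigma T t = t], it fails at the maximum of [T], where
    the jump operator takes a conventional value. *)
Definition right_dense (T : R -> Prop) (t : R) : Prop :=
  forall e, 0 < e -> exists s, T s /\ t < s < t + e.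

Definition left_dense (T : R -> Prop) (t : R) : Prop :=
  forall e, 0 < e -> exists s, T s /\ t - e < s < t.

Lemma right_dense_closed (T : R -> Prop) (t : R) :
  closed T -> right_dense T t -> T t.
Proof.
intros HT H. apply closed_accumulation; trivial. intros e He.
destruct (H e He) as [s [Ts Hs]]. exists s. split; trivial. apply Rabs_def1; lra.
Qed.

Lemma left_dense_closed (T : R -> Prop) (t : R) :
  closed T -> left_dense T t -> T t.
Proof.
intros HT H. apply closed_accumulation; trivial. intros e He.
destruct (H e He) as [s [Ts Hs]]. exists s. split; trivial. apply Rabs_def1; lra.
Qed.

Lemma not_right_dense (T : R -> Prop) (t : R) :
  ~ right_dense T t -> exists e, 0 < e /\ forall s, T s -> t < s -> t + e <= s.
Proof.
intros H. apply NNPP. intros Hn. apply H. intros e He. apply NNPP. intros Hn'.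
apply Hn. exists e. split; trivial. intros s Ts Hs. apply Rnot_lt_le. intros Hlt.
apply Hn'. exists s. repeat split; trivial.
Qed.

Lemma not_left_dense (T : R -> Prop) (t : R) :
  ~ left_dense T t -> exists e, 0 < e /\ forall s, T s -> s < t -> s <= t - e.
Proof.
intros H. apply NNPP. intros Hn. apply H. intros e He. apply NNPP. intros Hn'.
apply Hn. exists e. split; trivial. intros s Ts Hs. apply Rnot_lt_le. intros Hlt.
apply Hn'. exists s. repeat split; trivial.
Qed.

Lemma sigma_right_dense (T : R -> Prop) (t : R) :
  right_dense T t -> sigma T t = t.
Proof.
intros H. unfold sigma.
assert (E : Glb_Rbar (fun s => T s /\ t < s) = Finite t).
{ apply is_glb_Rbar_unique. split.
  - intros x [_ Hx]. simpl. lra.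
  - intros [b| |] Hb; simpl; trivial.
    + apply Rnot_lt_le. intros Hlt.
      destruct (H (b - t)) as [s [Ts Hs]]; [lra|].
      assert (Hbs := Hb s (conj Ts (proj1 Hs))). simpl in Hbs. lra.
    + destruct (H 1 Rlt_0_1) as [s [Ts Hs]].
      exact (Hb s (conj Ts (proj1 Hs))). }
now rewrite E.
Qed.

Lemma rho_left_dense (T : R -> Prop) (t : R) :
  left_dense T t -> rho T t = t.
Proof.
intros H. unfold rho.
assert (E : Lub_Rbar (fun s => T s /\ s < t) = Finite t).
{ apply is_lub_Rbar_unique. split.
  - intros x [_ Hx]. simpl. lra.
  - intros [b| |] Hb; simpl; trivial.
    + apply Rnot_lt_le. intros Hlt.
      destruct (H (t - b)) as [s [Ts Hs]]; [lra|].
      assert (Hbs := Hb s (conj Ts (proj2 Hs))). simpl in Hbs. lra.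
    + destruct (H 1 Rlt_0_1) as [s [Ts Hs]].
      exact (Hb s (conj Ts (proj2 Hs))). }
now rewrite E.
Qed.

(** The gap to the right of t makes the infimum defining sigma stay away from t, and
    closedness makes it a minimum. The point d makes it finite. *)
Lemma sigma_right_scattered (T : R -> Prop) (t d : R) :
  closed T -> T d -> t < d -> ~ right_dense T t ->
  T (sigma T t) /\ t < sigma T t <= d /\ forall s, T s -> t < s -> sigma T t <= s.
Proof.
intros HT Td td Hn.
destruct (not_right_dense _ _ Hn) as [e [He Hgap]].
unfold sigma. destruct (Glb_Rbar_correct (fun s => T s /\ t < s)) as [Hlb Hgr].
set (m := Glb_Rbar _) in *.
assert (H1 := Hlb d (conj Td td)).
assert (H2 : Rbar_le (t + e) m) by (apply Hgr; intros x [Tx Hx]; exact (Hgap x Tx Hx)).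
destruct m as [m| |]; simpl in *; try easy.
assert (Hm : forall s, T s -> t < s -> m <= s) by (intros s Ts Hs; exact (Hlb s (conj Ts Hs))).
split; [|split; [lra|exact Hm]].
apply closed_accumulation; trivial. intros e' He'. apply NNPP. intros Hn'.
assert (Hc : m + e' <= m); [|lra].
apply (Hgr (m + e')). intros x [Tx Hx]. simpl. apply Rnot_lt_le. intros Hlt.
apply Hn'. exists x. split; trivial. assert (Hmx := Hm x Tx Hx). apply Rabs_def1; lra.
Qed.

Lemma sigma_cases (T : R -> Prop) (t : R) :
  closed T ->
  sigma T t = t \/
  T (sigma T t) /\ t < sigma T t /\ forall s, T s -> t < s -> sigma T t <= s.
Proof.
intros HT. destruct (classic (right_dense T t)) as [Hd|Hd].
- left. apply sigma_right_dense; trivial.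
- destruct (classic (exists d, T d /\ t < d)) as [[d [Td td]]|Hn].
  + right. destruct (sigma_right_scattered T t d HT Td td Hd) as [H1 [H2 H3]].
    repeat split; trivial; lra.
  + left. unfold sigma.
    assert (E : Glb_Rbar (fun s => T s /\ t < s) = p_infty).
    { apply is_glb_Rbar_unique. split.
      - intros x Hx. exfalso. apply Hn. exists x; trivial.
      - intros [b| |] _; simpl; trivial. }
    now rewrite E.
Qed.

Lemma rho_left_scattered (T : R -> Prop) (t c : R) :
  closed T -> T c -> c < t -> ~ left_dense T t ->
  T (rho T t) /\ c <= rho T t < t /\ forall s, T s -> s < t -> s <= rho T t.
Proof.
intros HT Tc ct Hn.
destruct (not_left_dense _ _ Hn) as [e [He Hgap]].
unfold rho. destruct (Lub_Rbar_correct (fun s => T s /\ s < t)) as [Hub Hle].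
set (m := Lub_Rbar _) in *.
assert (H1 := Hub c (conj Tc ct)).
assert (H2 : Rbar_le m (t - e)) by (apply Hle; intros x [Tx Hx]; exact (Hgap x Tx Hx)).
destruct m as [m| |]; simpl in *; try easy.
assert (Hm : forall s, T s -> s < t -> s <= m) by (intros s Ts Hs; exact (Hub s (conj Ts Hs))).
split; [|split; [lra|exact Hm]].
apply closed_accumulation; trivial. intros e' He'. apply NNPP. intros Hn'.
assert (Hc : m <= m - e'); [|lra].
apply (Hle (m - e')). intros x [Tx Hx]. simpl. apply Rnot_lt_le. intros Hlt.
apply Hn'. exists x. split; trivial. assert (Hmx := Hm x Tx Hx). apply Rabs_def1; lra.
Qed.

(** * Delta-derivatives and monotonicity *)

(** A point t below d admits one step to the right along which F is as linear as desired:
    to sigma t if there is a gap, to a nearby point otherwise. This is the form in which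
    the derivative enters an induction on the time scale. *)
Lemma delta_derive_right (T : R -> Prop) (F : R -> R) (t d l e : R) :
  closed T -> T t -> T d -> t < d -> is_delta_derive T F t l -> 0 < e ->
  exists s, T s /\ t < s <= d /\ Rabs (F s - F t - l * (s - t)) <= e * (s - t).
Proof.
intros HT Tt Td td HF He.
destruct (HF (mkposreal e He)) as [dl Hdl]. simpl in Hdl.
destruct (classic (right_dense T t)) as [Hd|Hd].
- rewrite (sigma_right_dense _ _ Hd) in Hdl.
  destruct (Hd (Rmin dl (d - t))) as [s [Ts Hs]].
  { apply Rmin_glb_lt; [apply cond_pos|lra]. }
  assert (H1 := Rmin_l dl (d - t)). assert (H2 := Rmin_r dl (d - t)).
  exists s. split; [trivial|split; [lra|]].
  assert (H := Hdl s).
  replace (F s - F t - l * (s - t)) with (- (F t - F s - l * (t - s))) by ring.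
  rewrite Rabs_Ropp. eapply Rle_trans; [apply H; trivial|].
  + apply Rabs_def1; unfold minus, plus, opp; simpl; lra.
  + rewrite (Rabs_left (t - s)); lra.
- destruct (sigma_right_scattered T t d HT Td td Hd) as [Ts [Hs _]].
  exists (sigma T t). split; [trivial|split; [trivial|]].
  assert (H := Hdl t (ball_center _ _) Tt).
  rewrite (Rabs_right (sigma T t - t)) in H; lra.
Qed.

(** At a right-scattered t the derivative compares with F(sigma t), not with F(t); but the
    increment from t to sigma t is exact, and subtracting it leaves continuity at t. *)
Lemma delta_derive_continuous (T : R -> Prop) (F : R -> R) (t l : R) :
  closed T -> T t -> is_delta_derive T F t l ->
  filterlim F (within T (locally t)) (locally (F t)).
Proof.
intros HT Tt HF. apply filterlim_withinE. intros e He.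
set (r := sigma T t).
assert (Hr : t <= r /\ forall s, T s -> t < s -> r <= s \/ r = t).
{ unfold r. destruct (sigma_cases T t HT) as [->|[_ [H1 H2]]]; split; intros; try lra.
  left. apply H2; trivial. }
destruct Hr as [Hr Hmin].
(* Testing the derivative at s = t, for every tolerance, makes the increment exact. *)
assert (Hex : F r - F t = l * (r - t)).
{ apply Rminus_diag_uniq, cond_eq. intros e1 He1. rewrite Rminus_0_r.
  assert (Hp : 0 < e1 / (r - t + 1)) by (apply Rdiv_lt_0_compat; lra).
  destruct (HF (mkposreal _ Hp)) as [dl Hdl]. simpl in Hdl.
  assert (H := Hdl t (ball_center _ _) Tt). fold r in H.
  eapply Rle_lt_trans; [exact H|]. rewrite Rabs_right by lra.
  apply (Rlt_le_trans _ (e1 / (r - t + 1) * (r - t + 1))); [|right; field; lra].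
  apply Rmult_lt_compat_l; lra. }
set (w := r - t + 1).
assert (Hp : 0 < e / (2 * w)) by (apply Rdiv_lt_0_compat; unfold w; lra).
destruct (HF (mkposreal _ Hp)) as [dl Hdl]. simpl in Hdl. fold r in Hdl.
set (M := 2 * (1 + Rabs l)). assert (HM : 0 < M) by (unfold M; assert (H := Rabs_pos l); lra).
assert (HeM : 0 < e / M) by (apply Rdiv_lt_0_compat; lra).
exists (Rmin dl (Rmin 1 (e / M))). split.
{ repeat apply Rmin_glb_lt; try lra. apply cond_pos. }
intros s Ts Hst.
assert (H1 := Rmin_l dl (Rmin 1 (e / M))). assert (H2 := Rmin_r dl (Rmin 1 (e / M))).
assert (H3 := Rmin_l 1 (e / M)). assert (H4 := Rmin_r 1 (e / M)).
assert (H : Rabs (F r - F s - l * (r - s)) <= e / (2 * w) * Rabs (r - s)).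
{ apply Hdl; trivial. change (Rabs (s - t) < dl). lra. }
assert (Hw : Rabs (r - s) <= w).
{ unfold w. apply Rabs_def2 in Hst. apply Rabs_le. split; [|lra].
  destruct (Rle_lt_dec s t) as [Hle|Hlt]; [lra|]. destruct (Hmin s Ts Hlt); lra. }
assert (Hw2 : e / (2 * w) * Rabs (r - s) <= e / 2).
{ replace (e / 2) with (e / (2 * w) * w) by (field; unfold w; lra).
  apply Rmult_le_compat_l; lra. }
replace (F s - F t) with (- (F r - F s - l * (r - s)) + l * (s - t))
  by (replace (F t) with (F r - l * (r - t)) by lra; ring).
eapply Rle_lt_trans; [apply Rabs_triang|]. rewrite Rabs_Ropp, Rabs_mult.
assert (Hl : Rabs l * Rabs (s - t) < e / 2); [|lra].
assert (HP := Rabs_pos l).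
apply (Rle_lt_trans _ ((1 + Rabs l) * Rabs (s - t))).
- apply Rmult_le_compat_r; [apply Rabs_pos|lra].
- replace (e / 2) with ((1 + Rabs l) * (e / M)) by (unfold M; field; lra).
  apply Rmult_lt_compat_l; lra.
Qed.

(** By induction on x, F c - F x <= e (x - c) for every e > 0. Left limits are passed by
    continuity rather than by the derivative: at a point that is left-dense and
    right-scattered the derivative gives no linear control from the left. *)
Lemma delta_derive_nonneg_incr (T : R -> Prop) (F l : R -> R) (c d : R) :
  closed T -> T c -> T d -> c <= d ->
  (forall t, T t -> c <= t < d -> is_delta_derive T F t (l t) /\ 0 <= l t) ->
  filterlim F (within (fun s => T s /\ c <= s <= d) (locally d)) (locally (F d)) ->
  F c <= F d.
Proof.
intros HT Tc Td cd HF Hd.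
apply Rnot_lt_le. intros Hlt.
set (e := (F c - F d) / (2 * (d - c + 1))).
assert (He : 0 < e) by (apply Rdiv_lt_0_compat; lra).
assert (HQ : F c - F d <= e * (d - c)).
{ change ((fun x => F c - F x <= e * (x - c)) d).
  apply (time_scale_induction T _ c d); trivial; try lra.
  - intros t Tt Ht Qt. destruct (HF t Tt Ht) as [Dt lt0].
    destruct (delta_derive_right T F t d (l t) e) as [s [Ts [Hs H]]]; trivial; try lra.
    exists s. repeat split; trivial; try lra.
    apply Rabs_le_between in H.
    assert (0 <= l t * (s - t)) by (apply Rmult_le_pos; lra). lra.
  - intros t Tt Ht Hacc.
    assert (Hc : filterlim F (within (fun s => T s /\ c <= s <= d) (locally t)) (locally (F t))).
    { destruct (Rle_lt_or_eq_dec t d) as [Htd|E]; [lra| |now rewrite E].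
      apply filterlim_withinE. intros e1 He1.
      destruct (HF t Tt) as [Dt _]; [lra|].
      destruct (proj1 (filterlim_withinE _ _ _ _)
        (delta_derive_continuous T F t _ HT Tt Dt) e1 He1) as [dl [Hdl H]].
      exists dl. split; trivial. intros s [Ts _]. exact (H s Ts). }
    apply Rnot_lt_le. intros Hlt'.
    destruct (proj1 (filterlim_withinE _ _ _ _) Hc (F c - F t - e * (t - c))) as [dl [Hdl H]]; [lra|].
    destruct (Hacc dl Hdl) as [s [Ts [Hcs [Hs Qs]]]].
    assert (H1 := H s). destruct (Rabs_def2 (F s - F t) (F c - F t - e * (t - c))) as [H2 H3].
    { apply H1; [repeat split; trivial; lra|apply Rabs_def1; lra]. }
    assert (e * (s - c) <= e * (t - c)) by (apply Rmult_le_compat_l; lra). lra. }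
assert (e * (d - c) < F c - F d); [|lra].
assert (e * (2 * (d - c + 1)) = F c - F d) by (unfold e; field; lra).
assert (e * (d - c) < e * (2 * (d - c + 1))) by (apply Rmult_lt_compat_l; lra). lra.
Qed.

(** * Riemann integrability of regulated functions *)

(** One-sided limits make h uniformly approximable by step functions, by induction along
    the interval; Riemann integrability passes to uniform limits. *)
Lemma regulated_ex_RInt (h : R -> R) (c d : R) :
  c <= d ->
  (forall t, c <= t < d -> exists r, forall e, 0 < e -> exists dl, 0 < dl /\
     forall y, t < y < t + dl -> y < d -> Rabs (h y - r) <= e) ->
  (forall t, c < t <= d -> exists l, forall e, 0 < e -> exists dl, 0 < dl /\
     forall y, t - dl < y < t -> c < y -> Rabs (h y - l) <= e) ->
  ex_RInt h c d.
Proof.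
intros cd Hr Hl.
assert (Happrox : forall e, 0 < e -> exists phi : R -> R, ex_RInt phi c d /\
          forall y, c <= y <= d -> Rabs (phi y - h y) <= e).
{ intros e He.
  set (Q := fun x => exists phi : R -> R, ex_RInt phi c x /\
          forall y, c <= y <= x -> Rabs (phi y - h y) <= e).
  assert (Hext : forall s t r, c <= s < t -> Q s ->
            (forall y, s < y < t -> Rabs (h y - r) <= e) -> Q t).
  { intros s t r Hst [phi [Hphi Hh]] Hr'.
    exists (fun y => if Rle_dec y s then phi y else if Rlt_dec y t then r else h y). split.
    - apply ex_RInt_Chasles with s.
      + apply (ex_RInt_ext phi); trivial. rewrite Rmin_left, Rmax_right by lra.
        intros x Hx. destruct (Rle_dec x s); trivial; lra.
      + apply (ex_RInt_ext (fun _ => r)); [|apply ex_RInt_const].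
        rewrite Rmin_left, Rmax_right by lra. intros x Hx.
        destruct (Rle_dec x s); [lra|]. destruct (Rlt_dec x t); trivial; lra.
    - intros y Hy. destruct (Rle_dec y s); [apply Hh; lra|].
      destruct (Rlt_dec y t).
      + rewrite Rabs_minus_sym. apply Hr'; lra.
      + rewrite Rminus_diag, Rabs_R0. lra. }
  change (Q d).
  apply (time_scale_induction (fun _ => True) Q c d); trivial.
  - apply closed_true.
  - exists h. split; [apply ex_RInt_point|]. intros y _. rewrite Rminus_diag, Rabs_R0; lra.
  - intros t _ Ht Qt. destruct (Hr t Ht) as [r Hrt]. destruct (Hrt e He) as [dl [Hdl H]].
    exists (Rmin (t + dl) d). assert (H1 := Rmin_l (t + dl) d). assert (H2 := Rmin_r (t + dl) d).
    assert (H3 : t < Rmin (t + dl) d) by (apply Rmin_glb_lt; lra).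
    split; [trivial|split; [lra|]]. apply (Hext t _ r); trivial; try lra.
    intros y Hy. apply H; lra.
  - intros t _ Ht Hacc. destruct (Hl t Ht) as [l Hlt]. destruct (Hlt e He) as [dl [Hdl H]].
    destruct (Hacc dl Hdl) as [s [_ [Hcs [Hs Qs]]]].
    apply (Hext s t l); trivial; try lra. intros y Hy. apply H; lra. }
assert (Hseq : forall n : nat, exists phi : R -> R, ex_RInt phi c d /\
          forall y, Rabs (phi y - h y) <= / (INR n + 1)).
{ intros n. assert (Hn : 0 < INR n + 1) by (assert (H := pos_INR n); lra).
  assert (Hi := Rinv_0_lt_compat _ Hn).
  destruct (Happrox _ Hi) as [phi [Hphi H]].
  exists (fun y => if Rle_dec c y then if Rle_dec y d then phi y else h y else h y). split.
  - apply (ex_RInt_ext phi); trivial. rewrite Rmin_left, Rmax_right by lra.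
    intros x Hx. destruct (Rle_dec c x); [|lra]. destruct (Rle_dec x d); [trivial|lra].
  - intros y. destruct (Rle_dec c y); [destruct (Rle_dec y d)|].
    + apply H; lra.
    + rewrite Rminus_diag, Rabs_R0; lra.
    + rewrite Rminus_diag, Rabs_R0; lra. }
set (phi := fun n => proj1_sig (constructive_indefinite_description _ (Hseq n))).
assert (Hphi : forall n, ex_RInt (phi n) c d /\
                 forall y, Rabs (phi n y - h y) <= / (INR n + 1)).
{ intros n. exact (proj2_sig (constructive_indefinite_description _ (Hseq n))). }
destruct (filterlim_RInt phi c d eventually _ h (fun n => RInt (phi n) c d)) as [I [_ HI]].
- intros n. apply (RInt_correct (phi n)), Hphi.
- apply (filterlim_locally (U := fct_UniformSpace R R_UniformSpace)). intros [e He].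
  destruct (nfloor_ex (/ e)) as [n Hn]; [left; apply Rinv_0_lt_compat; trivial|].
  exists n. intros m Hm y. simpl.
  change (Rabs (phi m y - h y) < e).
  eapply Rle_lt_trans; [apply Hphi|].
  rewrite <- (Rinv_inv e). apply Rinv_lt_contravar.
  + apply Rmult_lt_0_compat; [apply Rinv_0_lt_compat; trivial|].
    assert (H := pos_INR m); lra.
  + apply le_INR in Hm. lra.
- exists I. exact HI.
Qed.

(** * The delta-integral of rd-continuous functions *)

(** Composing with this projection extends a function on T to the real line by constants on
    the gaps, which turns delta-integrals into Riemann integrals. *)
Definition ts_floor (T : R -> Prop) (x : R) : R :=
  real (Lub_Rbar (fun s => T s /\ s <= x)).

Lemma ts_floor_spec (T : R -> Prop) (c x : R) :
  closed T -> T c -> c <= x ->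
  T (ts_floor T x) /\ c <= ts_floor T x <= x /\
  forall s, T s -> s <= x -> s <= ts_floor T x.
Proof.
intros HT Tc cx. unfold ts_floor.
destruct (Lub_Rbar_correct (fun s => T s /\ s <= x)) as [Hub Hle].
set (m := Lub_Rbar _) in *.
assert (H1 := Hub c (conj Tc cx)).
assert (H2 : Rbar_le m x) by (apply Hle; intros y [_ Hy]; exact Hy).
destruct m as [m| |]; simpl in *; try easy.
assert (Hm : forall s, T s -> s <= x -> s <= m) by (intros s Ts Hs; exact (Hub s (conj Ts Hs))).
split; [|split; [lra|exact Hm]].
apply closed_accumulation; trivial. intros e He. apply NNPP. intros Hn.
assert (Hc : m <= m - e); [|lra].
apply (Hle (m - e)). intros y [Ty Hy]. simpl. apply Rnot_lt_le. intros Hlt.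
apply Hn. exists y. split; trivial. assert (H := Hm y Ty Hy). apply Rabs_def1; lra.
Qed.

Lemma ts_floor_id (T : R -> Prop) (x : R) : closed T -> T x -> ts_floor T x = x.
Proof.
intros HT Tx. destruct (ts_floor_spec T x x HT Tx) as [_ [H _]]; lra.
Qed.

(** Rd-continuity as seen by the delta-integral over [c,d]: the value at d is ignored, and only
    the left limit is kept there. *)
Definition rd_on (T : R -> Prop) (c d : R) (h : R -> R) : Prop :=
  forall t, T t -> c <= t <= d ->
    (t < d -> right_dense T t ->
       filterlim h (within (fun s => T s /\ c <= s < d) (locally t)) (locally (h t))) /\
    exists l : R,
       filterlim h (within (fun s => T s /\ c <= s < t) (locally t)) (locally l).

Definition ts_int (T : R -> Prop) (h : R -> R) (c d : R) : R :=
  RInt (fun x => h (ts_floor T x)) c d.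

Lemma rd_on_sub (T : R -> Prop) (c d c' d' : R) (h : R -> R) :
  c <= c' -> d' <= d -> rd_on T c d h -> rd_on T c' d' h.
Proof.
intros Hc Hd H t Tt Ht. destruct (H t Tt) as [H1 [l H2]]; [lra|]. split.
- intros Htd Hrd. eapply filterlim_filter_le_1; [|apply H1; trivial; lra].
  intros P [dl HP]. exists dl. intros y Hy [Ty Hy']. apply HP; trivial. split; trivial; lra.
- exists l. eapply filterlim_filter_le_1; [|exact H2].
  intros P [dl HP]. exists dl. intros y Hy [Ty Hy']. apply HP; trivial. split; trivial; lra.
Qed.

Lemma rd_on_ext (T : R -> Prop) (c d : R) (h1 h2 : R -> R) :
  (forall s, T s -> c <= s < d -> h1 s = h2 s) -> rd_on T c d h1 -> rd_on T c d h2.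
Proof.
intros E H t Tt Ht. destruct (H t Tt Ht) as [H1 [l H2]]. split.
- intros Htd Hrd. rewrite <- E by (trivial; lra).
  eapply filterlim_within_ext; [|exact (H1 Htd Hrd)].
  intros x [Tx Hx]. apply E; trivial.
- exists l. eapply filterlim_within_ext; [|exact H2].
  intros x [Tx Hx]. apply E; trivial; lra.
Qed.

Lemma rd_on_comp (T : R -> Prop) (c d : R) (h p : R -> R) :
  (forall x, continuous p x) -> rd_on T c d h -> rd_on T c d (fun s => p (h s)).
Proof.
intros Hp H t Tt Ht. destruct (H t Tt Ht) as [H1 [l H2]]. split.
- intros Htd Hrd. eapply filterlim_comp; [exact (H1 Htd Hrd)|apply Hp].
- exists (p l). eapply filterlim_comp; [exact H2|apply Hp].
Qed.

Lemma rd_on_mult (T : R -> Prop) (c d : R) (h1 h2 : R -> R) :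
  rd_on T c d h1 -> rd_on T c d h2 -> rd_on T c d (fun s => h1 s * h2 s).
Proof.
intros H1 H2 t Tt Ht.
destruct (H1 t Tt Ht) as [H1r [l1 H1l]]. destruct (H2 t Tt Ht) as [H2r [l2 H2l]]. split.
- intros Htd Hrd.
  exact (filterlim_comp_2 _ _ _ (H1r Htd Hrd) (H2r Htd Hrd) (filterlim_mult (K := R_AbsRing) _ _)).
- exists (l1 * l2).
  exact (filterlim_comp_2 _ _ _ H1l H2l (filterlim_mult (K := R_AbsRing) _ _)).
Qed.

Lemma rd_on_plus (T : R -> Prop) (c d : R) (h1 h2 : R -> R) :
  rd_on T c d h1 -> rd_on T c d h2 -> rd_on T c d (fun s => h1 s + h2 s).
Proof.
intros H1 H2 t Tt Ht.
destruct (H1 t Tt Ht) as [H1r [l1 H1l]]. destruct (H2 t Tt Ht) as [H2r [l2 H2l]]. split.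
- intros Htd Hrd.
  exact (filterlim_comp_2 _ _ _ (H1r Htd Hrd) (H2r Htd Hrd)
           (filterlim_plus (V := R_NormedModule) _ _)).
- exists (l1 + l2).
  exact (filterlim_comp_2 _ _ _ H1l H2l (filterlim_plus (V := R_NormedModule) _ _)).
Qed.

Lemma rd_on_const (T : R -> Prop) (c d v : R) : rd_on T c d (fun _ => v).
Proof.
intros t Tt Ht. split; [intros _ _|exists v]; apply filterlim_const.
Qed.

(** Off the dense points of T the extension is locally constant on the side considered;
    at dense points its one-sided limits are those of h. *)
Lemma rd_on_ex_RInt (T : R -> Prop) (c d : R) (h : R -> R) :
  closed T -> T c -> c <= d -> rd_on T c d h ->
  ex_RInt (fun x => h (ts_floor T x)) c d.
Proof.
intros HT Tc cd H. apply regulated_ex_RInt; trivial.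
- intros t Ht. destruct (classic (right_dense T t)) as [Hd|Hd].
  + exists (h t). intros e He.
    assert (Tt := right_dense_closed T t HT Hd).
    destruct (H t Tt) as [Hr _]; [lra|].
    destruct (proj1 (filterlim_withinE _ _ _ _) (Hr (proj2 Ht) Hd) e He) as [dl [Hdl H']].
    exists dl. split; trivial. intros y Hy Hyd.
    destruct (ts_floor_spec T t y HT Tt) as [H1 [H2 H3]]; [lra|].
    left. apply H'; [split; trivial; lra|]. apply Rabs_def1; lra.
  + destruct (not_right_dense T t Hd) as [g [Hg Hgap]].
    exists (h (ts_floor T t)). intros e He. exists g. split; trivial. intros y Hy _.
    replace (ts_floor T y) with (ts_floor T t).
    { rewrite Rminus_diag, Rabs_R0; lra. }
    destruct (ts_floor_spec T c t HT Tc) as [H1 [H2 H3]]; [lra|].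
    destruct (ts_floor_spec T c y HT Tc) as [H4 [H5 H6]]; [lra|].
    apply Rle_antisym; [apply H6; trivial; lra|]. apply H3; trivial.
    apply Rnot_lt_le. intros Hlt. assert (Hg' := Hgap _ H4 Hlt). lra.
- intros t Ht. destruct (classic (left_dense T t)) as [Hd|Hd].
  + assert (Tt := left_dense_closed T t HT Hd).
    destruct (H t Tt) as [_ [l Hl]]; [lra|]. exists l. intros e He.
    destruct (proj1 (filterlim_withinE _ _ _ _) Hl e He) as [dl [Hdl H']].
    destruct (Hd dl Hdl) as [s [Ts Hs]].
    exists (t - s). split; [lra|]. intros y Hy Hcy.
    destruct (ts_floor_spec T c y HT Tc) as [H1 [H2 H3]]; [lra|].
    assert (Hsy := H3 s Ts). left. apply H'; [split; trivial; lra|]. apply Rabs_def1; lra.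
  + destruct (not_left_dense T t Hd) as [g [Hg Hgap]].
    set (m := Rmax c (t - g)). assert (Hm1 := Rmax_l c (t - g)). assert (Hm2 := Rmax_r c (t - g)).
    assert (Hm3 : m < t) by (apply Rmax_lub_lt; lra). fold m in Hm1, Hm2.
    exists (h (ts_floor T m)). intros e He. exists (t - m). split; [lra|]. intros y Hy Hcy.
    replace (ts_floor T y) with (ts_floor T m).
    { rewrite Rminus_diag, Rabs_R0; lra. }
    destruct (ts_floor_spec T c m HT Tc) as [H1 [H2 H3]]; [lra|].
    destruct (ts_floor_spec T c y HT Tc) as [H4 [H5 H6]]; [lra|].
    apply Rle_antisym; [apply H6; trivial; lra|]. apply H3; trivial.
    apply (Rle_trans _ (t - g)); [|lra]. apply Hgap; trivial; lra.
Qed.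

Lemma ts_int_point (T : R -> Prop) (h : R -> R) (c : R) : ts_int T h c c = 0.
Proof. exact (RInt_point (V := R_CompleteNormedModule) c _). Qed.

Lemma ts_int_Chasles (T : R -> Prop) (h : R -> R) (c m d : R) :
  closed T -> T c -> T m -> c <= m <= d -> rd_on T c d h ->
  ts_int T h c d = ts_int T h c m + ts_int T h m d.
Proof.
intros HT Tc Tm Hm H. symmetry.
apply (RInt_Chasles (V := R_CompleteNormedModule)); apply rd_on_ex_RInt; trivial;
  try lra; apply (rd_on_sub T c d); trivial; lra.
Qed.

Lemma ts_int_le (T : R -> Prop) (h1 h2 : R -> R) (c d : R) :
  closed T -> T c -> c <= d -> rd_on T c d h1 -> rd_on T c d h2 ->
  (forall s, T s -> c <= s < d -> h1 s <= h2 s) ->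
  ts_int T h1 c d <= ts_int T h2 c d.
Proof.
intros HT Tc cd H1 H2 Hle. apply RInt_le; trivial; try (apply rd_on_ex_RInt; trivial).
intros x Hx. destruct (ts_floor_spec T c x HT Tc) as [H3 [H4 _]]; [lra|].
apply Hle; trivial; lra.
Qed.

Lemma ts_int_ext (T : R -> Prop) (h1 h2 : R -> R) (c d : R) :
  closed T -> T c -> c <= d ->
  (forall s, T s -> c <= s < d -> h1 s = h2 s) ->
  ts_int T h1 c d = ts_int T h2 c d.
Proof.
intros HT Tc cd He. apply RInt_ext. rewrite Rmin_left, Rmax_right by trivial.
intros x Hx. destruct (ts_floor_spec T c x HT Tc) as [H3 [H4 _]]; [lra|].
apply He; trivial; lra.
Qed.

Lemma ts_int_const (T : R -> Prop) (c d v : R) : ts_int T (fun _ => v) c d = v * (d - c).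
Proof.
unfold ts_int. rewrite RInt_const. unfold scal; simpl; unfold mult; simpl; ring.
Qed.

Lemma ts_int_ge0 (T : R -> Prop) (h : R -> R) (c d : R) :
  closed T -> T c -> c <= d -> rd_on T c d h ->
  (forall s, T s -> c <= s < d -> 0 <= h s) -> 0 <= ts_int T h c d.
Proof.
intros HT Tc cd H Hp. replace 0 with (ts_int T (fun _ => 0) c d).
- apply ts_int_le; trivial. apply rd_on_const.
- rewrite ts_int_const. ring.
Qed.

Lemma ts_int_scal (T : R -> Prop) (h : R -> R) (c d v : R) :
  closed T -> T c -> c <= d -> rd_on T c d h ->
  ts_int T (fun s => v * h s) c d = v * ts_int T h c d.
Proof.
intros HT Tc cd H.
apply (RInt_scal (V := R_CompleteNormedModule)), rd_on_ex_RInt; trivial.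
Qed.

Lemma ts_int_plus (T : R -> Prop) (h1 h2 : R -> R) (c d : R) :
  closed T -> T c -> c <= d -> rd_on T c d h1 -> rd_on T c d h2 ->
  ts_int T (fun s => h1 s + h2 s) c d = ts_int T h1 c d + ts_int T h2 c d.
Proof.
intros HT Tc cd H1 H2.
apply (RInt_plus (V := R_CompleteNormedModule)); apply rd_on_ex_RInt; trivial.
Qed.

Lemma rd_on_bounded (T : R -> Prop) (h : R -> R) (c d : R) :
  closed T -> T c -> c <= d -> rd_on T c d h ->
  exists M, 0 < M /\ forall s, T s -> c <= s < d -> Rabs (h s) <= M.
Proof.
intros HT Tc cd H.
destruct (ex_RInt_ub _ _ _ (rd_on_ex_RInt T c d h HT Tc cd H)) as [M HM].
rewrite Rmin_left, Rmax_right in HM by trivial.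
assert (H0 : 0 <= M).
{ exact (Rle_trans _ _ _ (Rabs_pos (h (ts_floor T c))) (HM c (conj (Rle_refl c) cd))). }
exists (M + 1). split; [lra|]. intros s Ts Hs.
assert (H' := HM s). rewrite ts_floor_id in H' by trivial.
change (norm (h s)) with (Rabs (h s)) in H'. specialize (H' ltac:(lra)). lra.
Qed.

Lemma ts_int_abs_le (T : R -> Prop) (h : R -> R) (c d M : R) :
  closed T -> T c -> c <= d -> rd_on T c d h ->
  (forall s, T s -> c <= s < d -> Rabs (h s) <= M) ->
  Rabs (ts_int T h c d) <= M * (d - c).
Proof.
intros HT Tc cd H HM. apply Rabs_le.
split.
- replace (- (M * (d - c))) with (ts_int T (fun _ => - M) c d) by (rewrite ts_int_const; ring).
  apply ts_int_le; trivial; [apply rd_on_const|].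
  intros s Ts Hs. exact (proj1 (proj1 (Rabs_le_between _ _) (HM s Ts Hs))).
- rewrite <- (ts_int_const T). apply ts_int_le; trivial; [apply rd_on_const|].
  intros s Ts Hs. exact (proj2 (proj1 (Rabs_le_between _ _) (HM s Ts Hs))).
Qed.

Lemma closed_segment (T : R -> Prop) (c d : R) : closed T -> closed (segment T c d).
Proof.
intros HT. apply closed_and; trivial. apply closed_and; [apply closed_ge|apply closed_le].
Qed.

Lemma right_dense_segment (T : R -> Prop) (c d t : R) :
  c <= t < d -> right_dense T t -> right_dense (segment T c d) t.
Proof.
intros Ht H e He. destruct (H (Rmin e (d - t))) as [s [Ts Hs]].
{ apply Rmin_glb_lt; lra. }
assert (H1 := Rmin_l e (d - t)). assert (H2 := Rmin_r e (d - t)).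
exists s. repeat split; trivial; lra.
Qed.

(** The difference of two antiderivatives has derivative zero, so it is nondecreasing, and
    so is its opposite. *)
Lemma is_delta_int_unique (T : R -> Prop) (h : R -> R) (c d v1 v2 : R) :
  closed T -> T c -> T d -> c <= d ->
  is_delta_int T h c d v1 -> is_delta_int T h c d v2 -> v1 = v2.
Proof.
assert (Hle : forall v1 v2, closed T -> T c -> T d -> c <= d ->
  is_delta_int T h c d v1 -> is_delta_int T h c d v2 -> v1 <= v2).
{ clear v1 v2. intros v1 v2 HT Tc Td cd [F1 [H1 [C1 ->]]] [F2 [H2 [C2 ->]]].
  assert (H : F2 c - F1 c <= F2 d - F1 d); [|lra].
  apply (delta_derive_nonneg_incr (segment T c d) (fun x => F2 x - F1 x) (fun _ => 0) c d);
    trivial.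
  - apply closed_segment; trivial.
  - repeat split; trivial; lra.
  - repeat split; trivial; lra.
  - intros t St Ht. split; [|lra]. intros [e He].
    assert (He2 : 0 < e / 2) by lra.
    assert (G1 := H1 t St (proj2 Ht) (mkposreal _ He2)).
    assert (G2 := H2 t St (proj2 Ht) (mkposreal _ He2)).
    generalize (filter_and _ _ G1 G2). apply filter_imp. simpl. intros s [K1 K2].
    set (r := sigma (segment T c d) t) in *.
    replace (F2 r - F1 r - (F2 s - F1 s) - 0 * (r - s))
      with (F2 r - F2 s - h t * (r - s) + - (F1 r - F1 s - h t * (r - s))) by ring.
    eapply Rle_trans; [apply Rabs_triang|]. rewrite Rabs_Ropp. lra.
  - apply filterlim_withinE. intros e He.
    destruct (proj1 (filterlim_withinE _ _ _ _) C1 (e / 2)) as [d1 [Hd1 K1]]; [lra|].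
    destruct (proj1 (filterlim_withinE _ _ _ _) C2 (e / 2)) as [d2 [Hd2 K2]]; [lra|].
    exists (Rmin d1 d2). split; [apply Rmin_glb_lt; trivial|].
    assert (M1 := Rmin_l d1 d2). assert (M2 := Rmin_r d1 d2).
    intros s [Ss Hs] Hsd. specialize (K1 s Ss ltac:(lra)). specialize (K2 s Ss ltac:(lra)).
    apply Rabs_def2 in K1. apply Rabs_def2 in K2. apply Rabs_def1; lra. }
intros. apply Rle_antisym; apply Hle; trivial.
Qed.

Lemma ts_int_dist (T : R -> Prop) (h : R -> R) (c d v e : R) :
  closed T -> T c -> c <= d -> rd_on T c d h ->
  (forall s, T s -> c <= s < d -> Rabs (h s - v) <= e) ->
  Rabs (ts_int T h c d - v * (d - c)) <= e * (d - c).
Proof.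
intros HT Tc cd H He.
replace (ts_int T h c d - v * (d - c)) with (ts_int T (fun s => h s + - v) c d).
- apply ts_int_abs_le; trivial. apply rd_on_plus; trivial. apply rd_on_const.
- rewrite ts_int_plus by (trivial; apply rd_on_const). rewrite ts_int_const. ring.
Qed.

(** At a right-dense point the derivative of the primitive is h by continuity; over a gap
    the primitive is linear with slope h t, and points before t contribute little because
    the primitive is Lipschitz. *)
Lemma is_delta_int_ts_int (T : R -> Prop) (h : R -> R) (c d : R) :
  closed T -> T c -> T d -> c <= d -> rd_on T c d h ->
  is_delta_int T h c d (ts_int T h c d).
Proof.
intros HT Tc Td cd H.
destruct (rd_on_bounded T h c d HT Tc cd H) as [M [HM Hb]].
set (F := fun x => ts_int T h c x).
assert (Hinc : forall x y, T x -> T y -> c <= x <= y -> y <= d -> F y - F x = ts_int T h x y).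
{ intros x y Tx Ty Hx Hy. unfold F. rewrite (ts_int_Chasles T h c x y); trivial; try ring.
  apply (rd_on_sub T c d); trivial; lra. }
assert (Hlip : forall x y, T x -> T y -> c <= x <= y -> y <= d -> Rabs (F y - F x) <= M * (y - x)).
{ intros x y Tx Ty Hx Hy. rewrite Hinc by trivial. apply ts_int_abs_le; trivial; try lra.
  - apply (rd_on_sub T c d); trivial; lra.
  - intros s Ts Hs. apply Hb; trivial; lra. }
assert (HSc : closed (segment T c d)) by (apply closed_segment; trivial).
assert (Sd : segment T c d d) by (repeat split; trivial; lra).
exists F. split; [|split].
- intros t [Tt Ht] Htd [e He]. simpl.
  destruct (classic (right_dense T t)) as [Hd|Hd].
  + rewrite sigma_right_dense by (apply right_dense_segment; trivial; lra).
    destruct (H t Tt Ht) as [Hr _].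
    destruct (proj1 (filterlim_withinE _ _ _ _) (Hr Htd Hd) e He) as [dl [Hdl H']].
    exists (mkposreal dl Hdl). intros s Hs [Ts Hs'].
    change (Rabs (s - t) < dl) in Hs. apply Rabs_def2 in Hs.
    destruct (Rle_lt_dec s t) as [Hst|Hst].
    * rewrite Hinc by (trivial; lra). rewrite (Rabs_right (t - s)) by lra.
      apply ts_int_dist; trivial; try lra.
      -- apply (rd_on_sub T c d); trivial; lra.
      -- intros x Tx Hx. left. apply H'; [split; trivial; lra|apply Rabs_def1; lra].
    * replace (F t - F s - h t * (t - s)) with (- (F s - F t - h t * (s - t))) by ring.
      rewrite Rabs_Ropp, (Rabs_left (t - s)), Ropp_minus_distr by lra.
      rewrite Hinc by (trivial; lra).
      apply ts_int_dist; trivial; try lra.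
      -- apply (rd_on_sub T c d); trivial; lra.
      -- intros x Tx Hx. left. apply H'; [split; trivial; lra|apply Rabs_def1; lra].
  + assert (Hd' : ~ right_dense (segment T c d) t).
    { intros Hd'. apply Hd. intros e' He'. destruct (Hd' e' He') as [s [[Ts _] Hs]].
      exists s. split; trivial. }
    destruct (sigma_right_scattered (segment T c d) t d HSc Sd Htd Hd') as [[Tr _] [Hr Hmin]].
    set (r := sigma (segment T c d) t) in *.
    assert (Hjump : F r - F t = h t * (r - t)).
    { rewrite Hinc by (trivial; lra). rewrite <- (ts_int_const T).
      apply ts_int_ext; trivial; try lra. intros x Tx Hx.
      destruct (Rle_lt_or_eq_dec t x) as [Hlt|E]; [lra| |now rewrite E].
      assert (r <= x); [|lra]. apply Hmin; trivial. repeat split; trivial; lra. }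
    assert (Hp : 0 < Rmin (r - t) (e * (r - t) / (2 * M))).
    { apply Rmin_glb_lt; [lra|]. apply Rdiv_lt_0_compat; [|lra].
      apply Rmult_lt_0_compat; lra. }
    exists (mkposreal _ Hp). intros s Hs [Ts Hs'].
    change (Rabs (s - t) < Rmin (r - t) (e * (r - t) / (2 * M))) in Hs.
    assert (N1 := Rmin_l (r - t) (e * (r - t) / (2 * M))).
    assert (N2 := Rmin_r (r - t) (e * (r - t) / (2 * M))).
    apply Rabs_def2 in Hs.
    assert (Hst : s <= t).
    { apply Rnot_lt_le. intros Hlt. assert (r <= s); [|lra].
      apply Hmin; trivial. repeat split; trivial; lra. }
    rewrite (Rabs_right (r - s)) by lra.
    replace (F r - F s - h t * (r - s)) with (F t - F s - h t * (t - s))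
      by (replace (F r) with (F t + h t * (r - t)) by lra; ring).
    assert (G1 := Hlip s t Ts Tt (conj (proj1 Hs') Hst) (proj2 Ht)).
    assert (G2 : Rabs (h t * (t - s)) <= M * (t - s)).
    { rewrite Rabs_mult, (Rabs_right (t - s)) by lra. apply Rmult_le_compat_r; [lra|].
      apply Hb; trivial; lra. }
    assert (G3 : M * (t - s) <= e * (r - t) / 2).
    { replace (e * (r - t) / 2) with (M * (e * (r - t) / (2 * M))) by (field; lra).
      apply Rmult_le_compat_l; lra. }
    assert (G4 : e * (r - t) <= e * (r - s)) by (apply Rmult_le_compat_l; lra).
    unfold Rminus at 1. eapply Rle_trans; [apply Rabs_triang|]. rewrite Rabs_Ropp. lra.
- apply filterlim_withinE. intros e He. exists (e / (2 * M)).
  split; [apply Rdiv_lt_0_compat; lra|]. intros s [Ts Hs] Hsd. apply Rabs_def2 in Hsd.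
  rewrite Rabs_minus_sym. eapply Rle_lt_trans; [apply Hlip; trivial; lra|].
  replace e with (2 * (M * (e / (2 * M)))) by (field; lra).
  assert (M * (d - s) <= M * (e / (2 * M))) by (apply Rmult_le_compat_l; lra).
  assert (0 < M * (e / (2 * M))); [|lra].
  apply Rmult_lt_0_compat; trivial. apply Rdiv_lt_0_compat; lra.
- unfold F. rewrite ts_int_point. ring.
Qed.

Lemma is_delta_int_ext (T : R -> Prop) (h1 h2 : R -> R) (c d v : R) :
  (forall s, T s -> c <= s < d -> h1 s = h2 s) ->
  is_delta_int T h1 c d v -> is_delta_int T h2 c d v.
Proof.
intros E [F [H1 H2]]. exists F. split; trivial. intros t [Tt Ht] Htd.
rewrite <- E by (trivial; lra). apply H1; trivial. split; trivial.
Qed.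

(** The integrand h1 need only agree with h2 on [c,d): in iterated integrals the inner
    integral may have no meaning at the endpoint d. *)
Lemma Delta_int_ts_int (T : R -> Prop) (h1 h2 : R -> R) (c d : R) :
  closed T -> T c -> T d -> c <= d -> rd_on T c d h2 ->
  (forall s, T s -> c <= s < d -> h1 s = h2 s) ->
  Delta_int T h1 c d = ts_int T h2 c d.
Proof.
intros HT Tc Td cd H E.
assert (Hint : is_delta_int T h1 c d (ts_int T h2 c d)).
{ apply (is_delta_int_ext T h2); [intros s Ts Hs; symmetry; apply E; trivial|].
  apply is_delta_int_ts_int; trivial. }
apply (is_delta_int_unique T h1 c d); trivial.
unfold Delta_int. apply epsilon_spec. eexists; exact Hint.
Qed.

(** Density is allowed to be relative to another time scale T-prime, because the kernel is
    rd-continuous with respect to a segment of the time scale of the integral. *)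
Lemma rd_continuous_rd_on (T T' D : R -> Prop) (c d : R) (h : R -> R) :
  rd_continuous T' D h ->
  (forall s, T s -> c <= s < d -> D s) ->
  (D d \/ ~ left_dense T d) ->
  (forall s, T s -> c <= s < d -> right_dense T s -> right_dense T' s) ->
  (forall s, T s -> c < s <= d -> (forall e, 0 < e -> exists r, T r /\ c <= r /\ s - e < r < s) ->
     left_dense T' s) ->
  rd_on T c d h.
Proof.
intros Hrd HD Hd Hr Hl t Tt Ht. split.
- intros Htd Hrdt. destruct (Hrd t) as [H _]; [apply HD; trivial; lra|].
  eapply filterlim_filter_le_1; [|apply H, sigma_right_dense, Hr; trivial; lra].
  intros P [dl HP]. exists dl. intros y Hy [Ty Hy']. apply HP; trivial. apply HD; trivial.
- destruct (classic (forall e, 0 < e -> exists r, T r /\ c <= r /\ t - e < r < t)) as [Hacc|Hn].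
  + assert (Hct : c < t) by (destruct (Hacc 1 Rlt_0_1) as [r [_ Hr1]]; lra).
    assert (Dt : D t).
    { destruct (Rle_lt_or_eq_dec t d) as [Htd|E]; [lra|apply HD; trivial; lra|].
      destruct Hd as [Dd|Hd]; [now rewrite E|]. exfalso. apply Hd. rewrite <- E.
      intros e He. destruct (Hacc e He) as [r [Tr [_ Hr1]]]. exists r; split; trivial. }
    destruct (Hrd t Dt) as [_ H].
    destruct H as [l H]; [apply rho_left_dense, Hl; trivial; lra|].
    exists l. eapply filterlim_filter_le_1; [|exact H].
    intros P [dl HP]. exists dl. intros y Hy [Ty Hy']. apply HP; trivial.
    split; [apply HD; trivial; lra|lra].
  + exists 0. apply filterlim_withinE. intros e He.
    apply not_all_ex_not in Hn. destruct Hn as [g Hg].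
    exists g. split; [apply NNPP; intros Hng; apply Hg; intros; contradiction|].
    intros s [Ts Hs] Hst. exfalso. apply Hg. intros _. exists s. apply Rabs_def2 in Hst.
    repeat split; trivial; lra.
Qed.

(** * The primitive of a reciprocal and its inverse *)

Lemma continuous_Rmax_const (v x : R) : continuous (fun y => Rmax v y) x.
Proof.
apply filterlim_locally. intros [e He]. exists (mkposreal e He). intros y Hy.
change (Rabs (y - x) < e) in Hy. change (Rabs (Rmax v y - Rmax v x) < e).
apply Rabs_def2 in Hy. apply Rabs_def1; unfold Rmax; destruct (Rle_dec v y), (Rle_dec v x); lra.
Qed.

(** A gauge is only controlled on the nonnegative reals; clipping its
    argument gives a function that is continuous on the whole line. *)
Lemma gauge_continuous_clip (phi : R -> R) (x : R) :
  gauge phi -> continuous (fun y => phi (Rmax 0 y)) x.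
Proof.
intros [Hc _].
assert (H0 : nonneg_half (Rmax 0 x)) by apply Rmax_l.
apply (filterlim_comp _ _ _ (fun y => Rmax 0 y) phi (locally x)
        (within nonneg_half (locally (Rmax 0 x)))); [|exact (Hc _ H0)].
intros P HP. assert (H := continuous_Rmax_const 0 x _ HP). unfold filtermap in *.
eapply filter_imp; [|exact H]. simpl. intros y Hy. apply Hy. apply Rmax_l.
Qed.

Lemma gauge_comp (phi w : R -> R) : gauge phi -> gauge w -> gauge (fun s => phi (w s)).
Proof.
intros Gp Gw. destruct Gw as [Cw [w0 [wi wp]]].
assert (Gp' := Gp). destruct Gp' as [_ [p0 [pi pp]]].
repeat split.
- intros x Hx.
  apply (filterlim_within_ext nonneg_half (fun y => phi (Rmax 0 (w y)))).
  { intros y Hy. rewrite Rmax_right; trivial. apply w0; trivial. }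
  rewrite <- (Rmax_right 0 (w x)) by (apply w0; trivial).
  exact (filterlim_comp _ _ _ w (fun y => phi (Rmax 0 y)) _ _ _ (Cw x Hx)
           (gauge_continuous_clip phi (w x) Gp)).
- intros x Hx. apply p0, w0; trivial.
- intros x y Hx Hy. apply pi; [apply w0; trivial|apply wi; trivial].
- intros x Hx. apply pp, wp; trivial.
Qed.

(** The functions G and Psi are of this form, for the gauges g and Phi o W. *)
Definition recip_int (phi : R -> R) (x0 x : R) : R := RInt (fun s => 1 / phi s) x0 x.

Lemma ex_RInt_recip (phi : R -> R) (x y : R) :
  gauge phi -> 0 < x -> 0 < y -> ex_RInt (fun s => 1 / phi s) x y.
Proof.
intros G Hx Hy.
assert (Hm : 0 < Rmin x y) by (apply Rmin_glb_lt; trivial).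
apply (ex_RInt_ext (fun s => / phi (Rmax 0 s))).
{ intros s Hs. rewrite Rmax_right by lra. unfold Rdiv. now rewrite Rmult_1_l. }
apply (ex_RInt_continuous (V := R_CompleteNormedModule)). intros z Hz.
apply (continuous_Rinv_comp (fun s => phi (Rmax 0 s))).
- apply gauge_continuous_clip; trivial.
- rewrite Rmax_right by lra. apply Rgt_not_eq, G. lra.
Qed.

(** The integrand is nonincreasing, so it lies between its values at the endpoints. All
    that is needed of G and Psi follows from these two bounds. *)
Lemma recip_int_diff (phi : R -> R) (x0 x y : R) :
  gauge phi -> 0 < x0 -> 0 < x -> x <= y ->
  (y - x) / phi y <= recip_int phi x0 y - recip_int phi x0 x <= (y - x) / phi x.
Proof.
intros G Hx0 Hx Hxy. assert (Hy : 0 < y) by lra.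
assert (E : recip_int phi x0 y - recip_int phi x0 x = recip_int phi x y).
{ unfold recip_int.
  rewrite <- (RInt_Chasles (V := R_CompleteNormedModule) _ x0 x y); try (apply ex_RInt_recip; trivial).
  unfold plus; simpl. ring. }
rewrite E. unfold recip_int.
assert (Gx := proj2 (proj2 (proj2 G))). assert (Gi := proj1 (proj2 (proj2 G))).
assert (Hconst : forall v, RInt (fun _ => v) x y = v * (y - x)).
{ intros v. rewrite RInt_const. unfold scal; simpl; unfold mult; simpl; ring. }
split.
- replace ((y - x) / phi y) with (1 / phi y * (y - x)) by (unfold Rdiv; ring).
  rewrite <- Hconst.
  apply RInt_le; trivial; [apply ex_RInt_const|apply ex_RInt_recip; trivial|].
  intros s Hs. unfold Rdiv. rewrite !Rmult_1_l. apply Rinv_le_contravar; [apply Gx; lra|].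
  apply Gi; lra.
- replace ((y - x) / phi x) with (1 / phi x * (y - x)) by (unfold Rdiv; ring).
  rewrite <- Hconst.
  apply RInt_le; trivial; [apply ex_RInt_recip; trivial|apply ex_RInt_const|].
  intros s Hs. unfold Rdiv. rewrite !Rmult_1_l. apply Rinv_le_contravar; [apply Gx; lra|].
  apply Gi; lra.
Qed.

Lemma recip_int_incr (phi : R -> R) (x0 x y : R) :
  gauge phi -> 0 < x0 -> 0 < x -> x < y -> recip_int phi x0 x < recip_int phi x0 y.
Proof.
intros G Hx0 Hx Hxy.
destruct (recip_int_diff phi x0 x y G Hx0 Hx) as [H _]; [lra|].
assert (0 < (y - x) / phi y); [|lra].
apply Rdiv_lt_0_compat; [lra|]. apply G; lra.
Qed.

Lemma recip_int_le_inv (phi : R -> R) (x0 x y : R) :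
  gauge phi -> 0 < x0 -> 0 < x -> 0 < y ->
  recip_int phi x0 x <= recip_int phi x0 y -> x <= y.
Proof.
intros G Hx0 Hx Hy H. apply Rnot_lt_le. intros Hlt.
assert (H' := recip_int_incr phi x0 y x G Hx0 Hy Hlt). lra.
Qed.

Lemma inv_fun_spec (H : R -> R) (y : R) : dom_inv H y -> 0 < inv_fun H y /\ H (inv_fun H y) = y.
Proof. intros Hd. unfold inv_fun. apply epsilon_spec. exact Hd. Qed.

Lemma continuous_recip_int (phi : R -> R) (x0 x : R) :
  gauge phi -> 0 < x0 -> 0 < x -> continuity_pt (recip_int phi x0) x.
Proof.
intros G Hx0 Hx. apply continuity_pt_filterlim.
apply (ex_derive_continuous (K := R_AbsRing) (V := R_NormedModule)). exists (1 / phi x).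
apply (is_derive_RInt (V := R_NormedModule) (fun s => 1 / phi s) _ x0).
- exists (mkposreal x Hx). intros y Hy. change (Rabs (y - x) < x) in Hy. apply Rabs_def2 in Hy.
  apply (RInt_correct (V := R_CompleteNormedModule)), ex_RInt_recip; trivial; lra.
- apply (continuous_ext_loc _ (fun s => / phi (Rmax 0 s))).
  + exists (mkposreal x Hx). intros y Hy. change (Rabs (y - x) < x) in Hy. apply Rabs_def2 in Hy.
    rewrite Rmax_right by lra. unfold Rdiv. now rewrite Rmult_1_l.
  + apply (continuous_Rinv_comp (fun s => phi (Rmax 0 s))).
    * apply gauge_continuous_clip; trivial.
    * rewrite Rmax_right by lra. apply Rgt_not_eq, G; trivial.
Qed.

Lemma dom_inv_between (phi : R -> R) (x0 y1 y2 y : R) :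
  gauge phi -> 0 < x0 -> dom_inv (recip_int phi x0) y1 -> dom_inv (recip_int phi x0) y2 ->
  y1 <= y <= y2 -> dom_inv (recip_int phi x0) y.
Proof.
intros G Hx0 [a [Ha Ea]] [b [Hb Eb]] Hy.
destruct (Req_dec y y1) as [->|N1]; [exists a; split; trivial|].
destruct (Req_dec y y2) as [->|N2]; [exists b; split; trivial|].
assert (Hab : a < b).
{ apply Rnot_le_lt. intros Hle. destruct (Rle_lt_or_eq_dec _ _ Hle) as [Hlt|E].
  - assert (H := recip_int_incr phi x0 b a G Hx0 Hb Hlt). lra.
  - subst b. lra. }
destruct (Ranalysis5.IVT_interv (fun x => recip_int phi x0 x - y) a b) as [z [Hz Ez]]; try lra.
- intros x Hx. apply (continuity_pt_minus (recip_int phi x0) (fun _ => y)).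
  + apply continuous_recip_int; trivial; lra.
  + apply continuity_pt_const. intros ? ?; trivial.
- exists z. split; lra.
Qed.

(** The lower bound of [recip_int_diff], read on the inverse function. *)
Lemma inv_fun_lipschitz (phi : R -> R) (x0 y1 y2 : R) :
  gauge phi -> 0 < x0 -> dom_inv (recip_int phi x0) y1 -> dom_inv (recip_int phi x0) y2 ->
  y1 <= y2 ->
  0 <= inv_fun (recip_int phi x0) y2 - inv_fun (recip_int phi x0) y1
    <= phi (inv_fun (recip_int phi x0) y2) * (y2 - y1).
Proof.
intros G Hx0 D1 D2 Hy.
destruct (inv_fun_spec _ _ D1) as [P1 E1]. destruct (inv_fun_spec _ _ D2) as [P2 E2].
set (p1 := inv_fun (recip_int phi x0) y1) in *. set (p2 := inv_fun (recip_int phi x0) y2) in *.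
assert (H12 : p1 <= p2) by (apply (recip_int_le_inv phi x0); trivial; lra).
destruct (recip_int_diff phi x0 p1 p2 G Hx0 P1 H12) as [H _]. rewrite E1, E2 in H.
assert (Pp : 0 < phi p2) by (apply G; trivial).
split; [lra|]. replace (p2 - p1) with (phi p2 * ((p2 - p1) / phi p2)) by (field; lra).
apply Rmult_le_compat_l; lra.
Qed.

(** The inverse is Lipschitz between lo and hi; clipping extends it to a continuous
    function of a real variable, so that composing with it preserves rd-continuity. *)
Lemma inv_fun_continuous_extension (phi : R -> R) (x0 lo hi : R) :
  gauge phi -> 0 < x0 -> lo <= hi ->
  dom_inv (recip_int phi x0) lo -> dom_inv (recip_int phi x0) hi ->
  exists p : R -> R, (forall y, continuous p y) /\
    forall y, lo <= y <= hi -> p y = inv_fun (recip_int phi x0) y.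
Proof.
intros G Hx0 Hlh Dlo Dhi. set (J := inv_fun (recip_int phi x0)).
set (clip := fun y => Rmax lo (Rmin hi y)).
assert (Hclip : forall y, lo <= clip y <= hi).
{ intros y. split; [apply Rmax_l|]. apply Rmax_lub; [lra|apply Rmin_l]. }
exists (fun y => J (clip y)). split.
- intros y. apply filterlim_locally. intros [e He].
  assert (Hd : forall z, lo <= z <= hi -> dom_inv (recip_int phi x0) z).
  { intros z Hz. apply (dom_inv_between phi x0 lo hi); trivial. }
  set (M := phi (J hi)).
  assert (HM : 0 < M) by (apply G; apply (inv_fun_spec _ _ Dhi)).
  assert (Hlip : forall y1 y2, lo <= y1 <= y2 -> y2 <= hi -> Rabs (J y2 - J y1) <= M * (y2 - y1)).
  { intros y1 y2 H1 H2.
    destruct (inv_fun_lipschitz phi x0 y1 y2 G Hx0) as [K1 K2]; try (apply Hd; lra); try lra.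
    destruct (inv_fun_lipschitz phi x0 y2 hi G Hx0) as [K3 _]; try (apply Hd; lra); try lra.
    fold J in K1, K2, K3. rewrite Rabs_right by lra. eapply Rle_trans; [exact K2|].
    apply Rmult_le_compat_r; [lra|]. apply G; [|lra].
    left. apply (inv_fun_spec (recip_int phi x0)). apply Hd; lra. }
  assert (He' : 0 < e / M) by (apply Rdiv_lt_0_compat; lra).
  exists (mkposreal _ He'). intros z Hz. change (Rabs (z - y) < e / M) in Hz.
  change (Rabs (J (clip z) - J (clip y)) < e).
  assert (Hcz : Rabs (clip z - clip y) < e / M).
  { apply Rabs_def2 in Hz. unfold clip. apply Rabs_def1; unfold Rmax, Rmin;
      destruct (Rle_dec hi z), (Rle_dec hi y); repeat destruct (Rle_dec lo _); lra. }
  apply (Rle_lt_trans _ (M * Rabs (clip z - clip y))).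
  + destruct (Rle_lt_dec (clip y) (clip z)) as [Hle|Hlt].
    * rewrite (Rabs_right (clip z - clip y)) by lra. apply Hlip; [split|]; try apply Hclip; trivial.
    * rewrite Rabs_minus_sym, (Rabs_left (clip z - clip y)), Ropp_minus_distr by lra.
      apply Hlip; [split|]; try apply Hclip; lra.
  + replace e with (M * (e / M)) by (field; lra). apply Rmult_lt_compat_l; trivial.
- intros y Hy. unfold clip. rewrite Rmin_right, Rmax_right by lra. reflexivity.
Qed.

(** Taking z = x in the definition of S gives g(x) <= x g(1) for x >= 1, so the primitive
    of 1/g grows by at least 1/(2 g(1)) on each interval [2^n, 2^(n+1)] and is unbounded. *)
Lemma class_S_dom_inv (g : R -> R) (x0 y : R) :
  class_S g -> 0 < x0 -> 0 <= y -> dom_inv (recip_int g x0) (recip_int g x0 1 + y).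
Proof.
intros [G HS] Hx0 Hy.
assert (Gp := proj2 (proj2 (proj2 G))).
assert (Hlin : forall x, 1 <= x -> g x <= x * g 1).
{ intros x Hx. assert (K := HS x x ltac:(lra) Hx).
  replace (x / x) with 1 in K by (field; lra).
  apply (Rmult_le_compat_l x) in K; [|lra].
  replace (x * (1 / x * g x)) with (g x) in K by (field; lra). lra. }
assert (G1 := Gp 1 Rlt_0_1).
assert (Hgrow : forall n, recip_int g x0 1 + INR n * / (2 * g 1) <= recip_int g x0 (2 ^ n)).
{ induction n as [|n IH]; [simpl; lra|].
  assert (H1 : 1 <= 2 ^ n) by (apply pow_R1_Rle; lra).
  destruct (recip_int_diff g x0 (2 ^ n) (2 ^ S n) G Hx0) as [K _]; [lra|simpl; lra|].
  assert (P : 0 < g (2 ^ S n)) by (apply Gp; simpl; lra).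
  assert (K2 : / (2 * g 1) <= (2 ^ S n - 2 ^ n) / g (2 ^ S n)).
  { apply (Rmult_le_reg_r (g (2 ^ S n) * (2 * g 1))); [apply Rmult_lt_0_compat; lra|].
    replace (/ (2 * g 1) * (g (2 ^ S n) * (2 * g 1))) with (g (2 ^ S n)) by (field; lra).
    replace ((2 ^ S n - 2 ^ n) / g (2 ^ S n) * (g (2 ^ S n) * (2 * g 1)))
      with ((2 ^ S n - 2 ^ n) * 2 * g 1) by (field; lra).
    eapply Rle_trans; [apply Hlin; simpl; lra|]. simpl. lra. }
  rewrite S_INR. lra. }
destruct (nfloor_ex (y * (2 * g 1))) as [n [_ Hn]]; [apply Rmult_le_pos; lra|].
apply (dom_inv_between g x0 (recip_int g x0 1) (recip_int g x0 (2 ^ S n))); trivial.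
- exists 1. split; [lra|trivial].
- exists (2 ^ S n). split; [apply pow_lt; lra|trivial].
- split; [lra|]. eapply Rle_trans; [|apply Hgrow]. apply Rplus_le_compat_l.
  rewrite S_INR. apply (Rmult_le_reg_r (2 * g 1)); [lra|].
  rewrite Rmult_assoc, Rinv_l by lra. lra.
Qed.

(** * The comparison principle *)

(** The increment hypothesis is a form of R1' <= phi(R1) E' that makes sense at every
    kind of point: B is the value R1 s over a gap, R1 s' for a short step from a
    right-dense s, and the left limit of R1 for a step to a left-dense s'. Along a
    step on which phi(R1) varies by at most a factor 1 + e it gives
    H(R1 s') - H(R1 s) <= (1 + e) (E s' - E s) for the primitive H of 1/phi, since H has
    slope at most 1/phi(R1 s) beyond R1 s. Induction over the time scale and e -> 0
    conclude. *)
Lemma bihari_comparison (T : R -> Prop) (phi R1 E : R -> R) (x0 c d : R) :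
  closed T -> T c -> T d -> c <= d -> gauge phi -> 0 < x0 ->
  (forall s, T s -> c <= s <= d -> 0 < R1 s) ->
  (forall s s', T s -> T s' -> c <= s <= s' -> s' <= d -> R1 s <= R1 s') ->
  rd_on T c d R1 ->
  (forall s s' B, T s -> T s' -> c <= s < s' -> s' <= d ->
     (forall r, T r -> s <= r < s' -> R1 r <= B) ->
     R1 s' - R1 s <= phi B * (E s' - E s)) ->
  recip_int phi x0 (R1 d) - recip_int phi x0 (R1 c) <= E d - E c.
Proof.
intros HT Tc Td cd G Hx0 Hpos Hmono Hcont Hinc.
assert (Gi := proj1 (proj2 (proj2 G))). assert (Gp := proj2 (proj2 (proj2 G))).
set (H := recip_int phi x0).
assert (Ecd : forall s s', T s -> T s' -> c <= s < s' -> s' <= d -> 0 <= E s' - E s).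
{ intros s s' Ts Ts' Hs Hs'.
  assert (K := Hinc s s' (R1 s') Ts Ts' Hs Hs').
  assert (K1 := Hmono s s' Ts Ts'). assert (P := Gp _ (Hpos s' Ts' ltac:(lra))).
  apply Rnot_lt_le. intros Hlt.
  assert (K2 : R1 s' - R1 s <= phi (R1 s') * (E s' - E s)).
  { apply K. intros r Tr Hr. apply Hmono; trivial; lra. }
  assert (0 < phi (R1 s') * - (E s' - E s)) by (apply Rmult_lt_0_compat; lra).
  specialize (K1 ltac:(lra) Hs'). lra. }
assert (Hstep : forall e s s' B, 0 < e -> T s -> T s' -> c <= s < s' -> s' <= d ->
   (forall r, T r -> s <= r < s' -> R1 r <= B) -> phi B <= (1 + e) * phi (R1 s) ->
   H (R1 s') - H (R1 s) <= (1 + e) * (E s' - E s)).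
{ intros e s s' B He Ts Ts' Hs Hs' HB Hphi.
  assert (P := Hpos s Ts ltac:(lra)). assert (PG := Gp _ P).
  assert (K := Hinc s s' B Ts Ts' Hs Hs' HB).
  destruct (recip_int_diff phi x0 (R1 s) (R1 s') G Hx0 P) as [_ K1]; [apply Hmono; trivial; lra|].
  fold H in K1. eapply Rle_trans; [exact K1|].
  apply (Rmult_le_reg_l (phi (R1 s))); trivial.
  replace (phi (R1 s) * ((R1 s' - R1 s) / phi (R1 s))) with (R1 s' - R1 s) by (field; lra).
  eapply Rle_trans; [exact K|].
  replace (phi (R1 s) * ((1 + e) * (E s' - E s))) with ((1 + e) * phi (R1 s) * (E s' - E s)) by ring.
  apply Rmult_le_compat_r; trivial. apply (Ecd s s'); trivial. }
assert (Heps : forall e, 0 < e -> H (R1 d) - H (R1 c) <= (1 + e) * (E d - E c)).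
{ intros e He.
  change ((fun x => H (R1 x) - H (R1 c) <= (1 + e) * (E x - E c)) d).
  apply (time_scale_induction T _ c d); trivial; [lra| |].
  - intros t Tt Ht Qt.
    assert (P := Hpos t Tt ltac:(lra)). assert (PG := Gp _ P).
    destruct (classic (right_dense T t)) as [Hd|Hd].
    + assert (Hc := filterlim_comp _ _ _ _ _ _ _ _
        (proj1 (Hcont t Tt ltac:(lra)) (proj2 Ht) Hd) (gauge_continuous_clip phi (R1 t) G)).
      assert (Hgap : 0 < e * phi (R1 t)) by (apply Rmult_lt_0_compat; trivial).
      destruct (proj1 (filterlim_withinE _ _ _ _) Hc _ Hgap) as [dl [Hdl Hnear]].
      destruct (Hd (Rmin dl (d - t))) as [s [Ts Hs]]; [apply Rmin_glb_lt; lra|].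
      assert (N1 := Rmin_l dl (d - t)). assert (N2 := Rmin_r dl (d - t)).
      exists s. split; [trivial|split; [lra|]].
      assert (Hst : H (R1 s) - H (R1 t) <= (1 + e) * (E s - E t)).
      { apply (Hstep e t s (R1 s)); trivial; try lra.
        - intros r Tr Hr. apply Hmono; trivial; lra.
        - assert (Hn := Hnear s ltac:(split; trivial; lra) ltac:(apply Rabs_def1; lra)).
          simpl in Hn. assert (Ps := Hpos s Ts ltac:(lra)).
          rewrite !Rmax_right in Hn by lra. apply Rabs_def2 in Hn. lra. }
      lra.
    + destruct (sigma_right_scattered T t d HT Td (proj2 Ht) Hd) as [Ts [Hs Hmin]].
      exists (sigma T t). split; [trivial|split; [trivial|]].
      assert (Hst : H (R1 (sigma T t)) - H (R1 t) <= (1 + e) * (E (sigma T t) - E t)).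
      { apply (Hstep e t _ (R1 t)); trivial; try lra.
        - intros r Tr Hr. apply Hmono; trivial; try lra.
          destruct (Rle_lt_or_eq_dec t r) as [Hlt|Heq]; [lra| |lra].
          assert (Hr' := Hmin r Tr Hlt). lra.
        - assert (0 < e * phi (R1 t)) by (apply Rmult_lt_0_compat; trivial). lra. }
      lra.
  - intros t Tt Ht Hacc.
    (* R1 need not be continuous from the left: its left limit L plays the role of B. *)
    set (A := fun y => exists s, T s /\ c <= s < t /\ y = R1 s).
    destruct (Hacc 1 Rlt_0_1) as [s0 [Ts0 [Hcs0 [Hs0 _]]]].
    destruct (completeness A) as [L [Hub Hleast]].
    { exists (R1 t). intros y [s [Ts [Hs ->]]]. apply Hmono; trivial; lra. }
    { exists (R1 s0). exists s0. repeat split; trivial; lra. }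
    assert (HL : forall s, T s -> c <= s < t -> R1 s <= L)
      by (intros s Ts Hs; apply Hub; exists s; repeat split; trivial; lra).
    assert (PL : 0 < L).
    { apply (Rlt_le_trans _ (R1 s0)); [apply Hpos; trivial; lra|apply HL; trivial; lra]. }
    assert (PGL := Gp _ PL).
    set (g := e * phi L / (1 + e)).
    assert (Hg : 0 < g).
    { apply Rdiv_lt_0_compat; [apply Rmult_lt_0_compat; trivial|lra]. }
    destruct (proj1 (filterlim_locally _ _) (gauge_continuous_clip phi L G) (mkposreal g Hg)) as [eta Heta].
    assert (Hs1 : exists s1, T s1 /\ c <= s1 < t /\ L - eta < R1 s1).
    { apply NNPP. intros Hn. assert (L <= L - eta); [|assert (K := cond_pos eta); lra].
      apply Hleast. intros y [s [Ts [Hs ->]]]. apply Rnot_lt_le. intros Hlt.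
      apply Hn. exists s. repeat split; trivial; lra. }
    destruct Hs1 as [s1 [Ts1 [Hs1 HR1]]].
    destruct (Hacc (t - s1)) as [s [Ts [Hcs [Hs Qs]]]]; [lra|].
    assert (Hs1s : R1 s1 <= R1 s) by (apply Hmono; trivial; lra).
    assert (Ps := Hpos s Ts ltac:(lra)).
    assert (HsL := HL s Ts ltac:(lra)).
    assert (Hst : H (R1 t) - H (R1 s) <= (1 + e) * (E t - E s)).
    { apply (Hstep e s t L); trivial; try lra.
      - intros r Tr Hr. apply HL; trivial; lra.
      - assert (Hn : Rabs (phi (Rmax 0 (R1 s)) - phi (Rmax 0 L)) < g).
        { apply (Heta (R1 s)). change (Rabs (R1 s - L) < eta). apply Rabs_def1; lra. }
        rewrite !Rmax_right in Hn by lra. apply Rabs_def2 in Hn.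
        assert ((1 + e) * g = e * phi L) by (unfold g; field; lra).
        assert ((1 + e) * (phi L - g) <= (1 + e) * phi (R1 s)) by (apply Rmult_le_compat_l; lra).
        lra. }
    lra. }
destruct (Rle_lt_or_eq_dec c d cd) as [Hlt|Heq]; [|rewrite Heq; lra].
assert (HE := Ecd c d Tc Td ltac:(lra) ltac:(lra)).
apply Rnot_lt_le. intros Hn.
set (D := H (R1 d) - H (R1 c)) in *.
assert (Hw : 0 < E d - E c + 1) by lra.
assert (He : 0 < (D - (E d - E c)) / (2 * (E d - E c + 1))) by (apply Rdiv_lt_0_compat; lra).
assert (K := Heps _ He).
assert (K2 : (D - (E d - E c)) / (2 * (E d - E c + 1)) * (E d - E c)
          <= (D - (E d - E c)) / (2 * (E d - E c + 1)) * (E d - E c + 1)) by (apply Rmult_le_compat_l; lra).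
replace ((D - (E d - E c)) / (2 * (E d - E c + 1)) * (E d - E c + 1))
  with ((D - (E d - E c)) / 2) in K2 by (field; lra).
lra.
Qed.

(** * Volterra operators with a kernel satisfying condition (K) *)

Lemma kappa_below (T : R -> Prop) (a b t : R) :
  T b -> T t -> a <= t < b -> kappa (segment T a b) t.
Proof.
intros Tb Tt Ht. split; [split; trivial; lra|]. intros [Hmax _].
assert (b <= t); [|lra]. apply Hmax. repeat split; trivial; lra.
Qed.

Lemma rho_segment_left (T : R -> Prop) (a b : R) : rho (segment T a b) a = a.
Proof.
unfold rho.
assert (El : Lub_Rbar (fun s => segment T a b s /\ s < a) = m_infty).
{ apply is_lub_Rbar_unique. split.
  - intros x [[_ Hx] Hx']. lra.
  - intros [y| |] _; simpl; trivial. }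
now rewrite El.
Qed.

(** The point removed by kappa can never be a limit from the left, so nothing is lost for
    rd-continuity on the whole segment. *)
Lemma kappa_or_left_scattered (T : R -> Prop) (a b t : R) :
  T a -> T b -> T t -> a <= t <= b -> kappa (segment T a b) t \/ ~ left_dense T t.
Proof.
intros Ta Tb Tt Ht. destruct (Rle_lt_or_eq_dec t b) as [Hlt|E]; [lra| |].
- left. apply kappa_below; trivial; lra.
- destruct (classic (kappa (segment T a b) t)) as [K|K]; [left; trivial|].
  right. intros Hd. apply K. split; [split; trivial|]. intros [_ Hrho].
  destruct (Rle_lt_or_eq_dec a t) as [Hat|Eat]; [lra| |].
  + rewrite rho_left_dense in Hrho; [lra|].
    intros e He. destruct (Hd (Rmin e (t - a))) as [s [Ts Hs]]; [apply Rmin_glb_lt; lra|].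
    assert (N1 := Rmin_l e (t - a)). assert (N2 := Rmin_r e (t - a)).
    exists s. repeat split; trivial; lra.
  + rewrite <- Eat, rho_segment_left in Hrho. lra.
Qed.

Lemma kappa_left (T : R -> Prop) (a b : R) : T a -> a <= b -> kappa (segment T a b) a.
Proof.
intros Ta Hab. split; [repeat split; trivial; lra|]. rewrite rho_segment_left. lra.
Qed.

(** The backward jump of t is the largest parameter s for which the kernel k(s,.) matters in
    an integral up to t. *)
Lemma kappa_rho (T : R -> Prop) (a b t : R) :
  closed T -> T a -> T b -> T t -> a <= t <= b ->
  kappa (segment T a b) (rho (segment T a b) t) /\
  forall s, T s -> a <= s < t -> s <= rho (segment T a b) t.
Proof.
intros HT Ta Tb Tt Ht.
destruct (classic (left_dense (segment T a b) t)) as [Hd|Hd].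
- rewrite (rho_left_dense _ _ Hd). split; [|intros; lra].
  destruct (kappa_or_left_scattered T a b t) as [K|K]; trivial.
  exfalso. apply K. intros e He. destruct (Hd e He) as [s [[Ts _] Hs]]. exists s; split; trivial.
- destruct (Rle_lt_or_eq_dec a t) as [Hat|<-]; [lra| |].
  + destruct (rho_left_scattered (segment T a b) t a) as [[Tr _] [Hr Hmax]]; trivial.
    * apply closed_segment; trivial.
    * repeat split; trivial; lra.
    * split; [apply kappa_below; trivial; lra|].
      intros s Ts Hs. apply Hmax; [repeat split; trivial|]; lra.
  + rewrite rho_segment_left. split; [apply kappa_left; trivial; lra|intros; lra].
Qed.

Lemma kappa_le_rho (T : R -> Prop) (a b s : R) :
  closed T -> T a -> T b -> a <= b -> kappa (segment T a b) s -> s <= rho (segment T a b) b.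
Proof.
intros HT Ta Tb Hab [[Ts Hs] Kn].
destruct (Rle_lt_or_eq_dec s b) as [Hlt|E]; [lra| |].
- apply (kappa_rho T a b b); trivial; lra.
- apply Rnot_lt_le. intros Hlt. apply Kn. split; [intros x [_ Hx]; lra|now rewrite E in Hlt |- *].
Qed.

(** What condition (K), together with the signs of k and of its derivative, gives on the
    triangle r <= s. The last clause bounds k only at times s and s' around a right-dense t,
    uniformly in r. Times s > a are distinguished because (K) starts after a. *)
Definition volterra_kernel (T : R -> Prop) (a b : R) (k : R -> R -> R) : Prop :=
  let K := kappa (segment T a b) in
  (forall s, K s -> a < s -> rd_on T a s (k s)) /\
  (forall s r, K s -> T r -> a <= r <= s -> 0 <= k s r) /\
  (forall s s' r, K s -> K s' -> T r -> a <= r <= s -> a < s <= s' -> k s r <= k s' r) /\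
  (forall t, K t -> a < t -> t < b -> right_dense T t -> exists M dl, 0 < dl /\ 0 <= M /\
     forall s s' r, K s -> K s' -> T r -> a <= r <= s -> a < s <= s' -> (s = t \/ s' = t) ->
       Rabs (s - t) < dl -> Rabs (s' - t) < dl -> k s' r <= k s r + M * (s' - s)).

(** With this kernel the Volterra operator is the primitive, so that regularity of
    primitives is a special case of [volterra_rd_on]. *)
Lemma volterra_kernel_one (T : R -> Prop) (a b : R) : volterra_kernel T a b (fun _ _ => 1).
Proof.
repeat split.
- intros. apply filterlim_const.
- exists 1. apply filterlim_const.
- intros; lra.
- intros; lra.
- intros. exists 0, 1. repeat split; intros; lra.
Qed.

(** Monotonicity comes from the sign of the derivative. For the Lipschitz clause,
    (K) makes k nearly affine in s near t, uniformly in r, and the slope is bounded in r because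
    k(t,.) >= 0 while k(s0,.) is bounded for a suitable s0 > t. *)
Lemma condition_K_volterra_kernel (T : R -> Prop) (a b : R) (k : R -> R -> R) :
  let Ts := segment T a b in
  closed T -> T a -> T b -> condition_K Ts a k ->
  (forall t s, Ts t -> Ts s -> s <= t -> 0 <= k t s) ->
  (forall t s, kappa Ts t -> Ts s -> s <= t ->
     ex_delta_derive Ts (fun r => k r s) t ->
     0 <= Delta_derive Ts (fun r => k r s) t) ->
  volterra_kernel T a b k.
Proof.
intros Ts HT Ta Tb HK Hk0 Hk1.
assert (HTs : closed Ts) by (apply closed_segment; trivial).
assert (Hge : forall t, t <= sigma Ts t).
{ intros t. destruct (sigma_cases Ts t HTs) as [->|[_ [H _]]]; lra. }
assert (Hrd : forall s, kappa Ts s -> a < s -> rd_on T a s (k s)).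
{ intros s Ks Has. destruct (HK s Ks Has) as [_ [H _]]. destruct Ks as [[Tss Hs] _].
  assert (Hge' := Hge s).
  apply (rd_continuous_rd_on T Ts (segment Ts a (sigma Ts s)) a s); trivial.
  - intros x Tx Hx. repeat split; trivial; lra.
  - left. repeat split; trivial; lra.
  - intros x Tx Hx Hd. apply right_dense_segment; trivial; lra.
  - intros x Tx Hx Hd e He. destruct (Hd e He) as [r [Tr [H1 H2]]].
    exists r. repeat split; trivial; lra. }
assert (Hder : forall t r, kappa Ts t -> a < t -> T r -> a <= r <= t ->
   is_delta_derive Ts (fun x => k x r) t (Delta_derive Ts (fun x => k x r) t) /\
   0 <= Delta_derive Ts (fun x => k x r) t).
{ intros t r Kt Hat Tr Hr.
  assert (Htb : a <= t <= b) by (destruct Kt as [[_ H] _]; exact H).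
  assert (Hd : is_delta_derive Ts (fun x => k x r) t (Delta_derive Ts (fun x => k x r) t)).
  { intros eps. destruct (HK t Kt Hat) as [_ [_ H]]. destruct (H eps) as [U [HU H']].
    unfold within. eapply filter_imp; [|exact HU]. intros s Us Tss. apply H'; trivial.
    assert (Hge' := Hge t). repeat split; trivial; lra. }
  split; trivial. apply Hk1; trivial; try lra; [split; trivial; lra|].
  eexists; exact Hd. }
split; [exact Hrd|split; [|split]].
- intros s r [[Tss Hs] _] Tr Hr. apply Hk0; try (split; trivial); lra.
- intros s s' r Ks Ks' Tr Hr Hs.
  assert (Hs1 := proj2 (proj1 Ks)). assert (Hs2 := proj2 (proj1 Ks')).
  apply (delta_derive_nonneg_incr Ts (fun x => k x r)
           (fun x => Delta_derive Ts (fun x => k x r) x) s s'); trivial; try lra.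
  + exact (proj1 Ks).
  + exact (proj1 Ks').
  + intros t [Tt Ht] Hts. apply Hder; trivial; try lra. apply kappa_below; trivial; lra.
  + eapply filterlim_filter_le_1;
      [|apply (delta_derive_continuous Ts (fun x => k x r) s' _ HTs (proj1 Ks')
                 (proj1 (Hder s' r Ks' ltac:(lra) Tr ltac:(lra))))].
    intros P [dl HP]. exists dl. intros y Hy [Ty _]. apply HP; trivial.
- intros t Kt Hat Htb Hd. assert (Tt := proj1 (proj1 Kt)).
  assert (Hd' : right_dense Ts t) by (apply right_dense_segment; trivial; lra).
  destruct (HK t Kt Hat) as [_ [_ H]]. destruct (H (mkposreal 1 Rlt_0_1)) as [U [[dl HU] HU']].
  rewrite (sigma_right_dense _ _ Hd') in HU'. simpl in HU'. clear H.
  (* A comparison point s0 > t makes the derivative bounded uniformly in r. *)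
  destruct (Hd (Rmin dl (b - t))) as [s0 [Ts0 Hs0]].
  { apply Rmin_glb_lt; [apply cond_pos|lra]. }
  assert (N1 := Rmin_l dl (b - t)). assert (N2 := Rmin_r dl (b - t)).
  assert (K0 : kappa Ts s0) by (apply kappa_below; trivial; lra).
  destruct (rd_on_bounded T (k s0) a s0 HT Ta) as [M0 [HM0 Hb0]]; [lra|apply Hrd; trivial; lra|].
  set (D := 1 + M0 / (s0 - t)).
  assert (HD : 0 <= M0 / (s0 - t)) by (left; apply Rdiv_lt_0_compat; lra).
  assert (HDb : forall r, T r -> a <= r <= t -> Delta_derive Ts (fun x => k x r) t <= D).
  { intros r Tr Hr.
    assert (H : Rabs (k t r - k s0 r - Delta_derive Ts (fun x => k x r) t * (t - s0))
                <= 1 * Rabs (t - s0)).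
    { apply HU'; [repeat split; trivial; lra|split; trivial; lra|].
      apply HU. change (Rabs (s0 - t) < dl). apply Rabs_def1; lra. }
    rewrite (Rabs_left (t - s0)) in H by lra. apply Rabs_le_between in H.
    assert (Hb := Hb0 r Tr ltac:(lra)). apply Rabs_le_between in Hb.
    assert (Hkt : 0 <= k t r) by (apply Hk0; try (split; trivial); lra).
    set (d := Delta_derive Ts (fun x => k x r) t) in *.
    apply (Rmult_le_reg_r (s0 - t)); [lra|].
    replace (D * (s0 - t)) with (s0 - t + M0) by (unfold D; field; lra). lra. }
  exists (D + 1), dl. split; [apply cond_pos|split; [unfold D; lra|]].
  intros s s' r Ks Ks' Tr Hr Hs Hor H1 H2.
  assert (Hst : (s = t \/ s' = t) -> a <= r <= t) by (intros [?|?]; lra).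
  assert (Hrt := Hst Hor).
  assert (Hdr := HDb r Tr Hrt).
  set (d := Delta_derive Ts (fun x => k x r) t) in *.
  assert (HUs : forall x, Ts x -> Rabs (x - t) < dl ->
     Rabs (k t r - k x r - d * (t - x)) <= 1 * Rabs (t - x)).
  { intros x Tx Hx. apply HU'; trivial; [repeat split; trivial; lra|apply HU; exact Hx]. }
  assert (Hm : d * (s' - s) <= D * (s' - s)) by (apply Rmult_le_compat_r; lra).
  destruct Hor as [E|E].
  + assert (K := HUs s' (proj1 Ks') H2). subst s.
    rewrite (Rabs_left1 (t - s')) in K by lra. apply Rabs_le_between in K. lra.
  + assert (K := HUs s (proj1 Ks) H1). subst s'.
    rewrite (Rabs_right (t - s)) in K by lra. apply Rabs_le_between in K. lra.
Qed.

Definition volterra (T : R -> Prop) (a : R) (k : R -> R -> R) (p : R -> R) (s : R) : R :=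
  ts_int T (fun r => k s r * p r) a s.

Lemma volterra_rd_integrand (T : R -> Prop) (a b : R) (k : R -> R -> R) (p : R -> R) (s c d : R) :
  volterra_kernel T a b k -> rd_on T a b p -> kappa (segment T a b) s ->
  a < s -> a <= c -> d <= s -> rd_on T c d (fun r => k s r * p r).
Proof.
intros [Hrd _] Hp Ks Has Hc Hd.
assert (Hs := proj2 (proj1 Ks)).
apply rd_on_mult.
- apply (rd_on_sub T a s); trivial. apply Hrd; trivial.
- apply (rd_on_sub T a b); trivial; lra.
Qed.

Lemma volterra_ge0 (T : R -> Prop) (a b : R) (k : R -> R -> R) (p : R -> R) (s : R) :
  closed T -> T a -> volterra_kernel T a b k -> rd_on T a b p -> kappa (segment T a b) s ->
  (forall r, T r -> a <= r < s -> 0 <= p r) -> 0 <= volterra T a k p s.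
Proof.
intros HT Ta Hk Hp Ks Hp0. assert (Hs := proj2 (proj1 Ks)). unfold volterra.
destruct (Rle_lt_or_eq_dec a s) as [Has|<-]; [lra| |rewrite ts_int_point; lra].
apply ts_int_ge0; trivial; try lra.
- apply (volterra_rd_integrand T a b); trivial; lra.
- intros r Tr Hr. apply Rmult_le_pos; [|apply Hp0; trivial].
  destruct Hk as [_ [H _]]. apply H; trivial; lra.
Qed.

Lemma volterra_incr (T : R -> Prop) (a b : R) (k : R -> R -> R) (p : R -> R) (s s' : R) :
  closed T -> T a -> volterra_kernel T a b k -> rd_on T a b p ->
  kappa (segment T a b) s -> kappa (segment T a b) s' -> s <= s' ->
  (forall r, T r -> a <= r < s' -> 0 <= p r) ->
  volterra T a k p s <= volterra T a k p s'.
Proof.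
intros HT Ta Hk Hp Ks Ks' Hss Hp0. assert (Hs := proj2 (proj1 Ks)).
destruct (Rle_lt_or_eq_dec a s) as [Has|<-]; [lra| |].
- unfold volterra. rewrite (ts_int_Chasles T (fun r => k s' r * p r) a s s'); trivial; try lra.
  + assert (H1 : ts_int T (fun r => k s r * p r) a s <= ts_int T (fun r => k s' r * p r) a s).
    { apply ts_int_le; trivial; try lra;
        try (apply (volterra_rd_integrand T a b); trivial; lra).
      intros r Tr Hr. apply Rmult_le_compat_r; [apply Hp0; trivial; lra|].
      destruct Hk as [_ [_ [H _]]]. apply H; trivial; lra. }
    assert (H2 : 0 <= ts_int T (fun r => k s' r * p r) s s'); [|lra].
    apply ts_int_ge0; trivial.
    * exact (proj1 (proj1 Ks)).
    * apply (volterra_rd_integrand T a b); trivial; lra.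
    * intros r Tr Hr. apply Rmult_le_pos; [|apply Hp0; trivial; lra].
      destruct Hk as [_ [H _]]. apply H; trivial; lra.
  + exact (proj1 (proj1 Ks)).
  + apply (volterra_rd_integrand T a b); trivial; lra.
- unfold volterra at 1. rewrite ts_int_point.
  apply (volterra_ge0 T a b); trivial.
Qed.

Lemma volterra_lincomb (T : R -> Prop) (a b : R) (k : R -> R -> R) (p1 p2 : R -> R) (v1 v2 s : R) :
  closed T -> T a -> volterra_kernel T a b k -> rd_on T a b p1 -> rd_on T a b p2 ->
  kappa (segment T a b) s ->
  volterra T a k (fun r => v1 * p1 r + v2 * p2 r) s
  = v1 * volterra T a k p1 s + v2 * volterra T a k p2 s.
Proof.
intros HT Ta Hk Hp1 Hp2 Ks. assert (Hs := proj2 (proj1 Ks)). unfold volterra.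
destruct (Rle_lt_or_eq_dec a s) as [Has|<-]; [lra| |rewrite !ts_int_point; ring].
assert (H1 : rd_on T a s (fun r => k s r * p1 r)) by (apply (volterra_rd_integrand T a b); trivial; lra).
assert (H2 : rd_on T a s (fun r => k s r * p2 r)) by (apply (volterra_rd_integrand T a b); trivial; lra).
rewrite <- !ts_int_scal by (trivial; lra).
rewrite <- ts_int_plus; trivial; try lra.
- apply ts_int_ext; trivial; try lra. intros r _ _. ring.
- apply rd_on_mult; [apply rd_on_const|trivial].
- apply rd_on_mult; [apply rd_on_const|trivial].
Qed.

(** Applied to v p2 - p1, monotonicity of the Volterra integral compares increments. This
    replaces differentiation of the integral with respect to s. *)
Lemma volterra_increment_le (T : R -> Prop) (a b : R) (k : R -> R -> R) (p1 p2 : R -> R) (v s s' : R) :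
  closed T -> T a -> volterra_kernel T a b k -> rd_on T a b p1 -> rd_on T a b p2 ->
  kappa (segment T a b) s -> kappa (segment T a b) s' -> s <= s' ->
  (forall r, T r -> a <= r < s' -> p1 r <= v * p2 r) ->
  volterra T a k p1 s' - volterra T a k p1 s <= v * (volterra T a k p2 s' - volterra T a k p2 s).
Proof.
intros HT Ta Hk Hp1 Hp2 Ks Ks' Hss Hle.
assert (H : volterra T a k (fun r => -1 * p1 r + v * p2 r) s
         <= volterra T a k (fun r => -1 * p1 r + v * p2 r) s').
{ apply (volterra_incr T a b); trivial.
  - apply rd_on_plus; apply rd_on_mult; trivial; apply rd_on_const.
  - intros r Tr Hr. assert (Hr' := Hle r Tr Hr). lra. }
rewrite !(volterra_lincomb T a b) in H by trivial. lra.
Qed.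

Lemma monotone_left_limit (h : R -> R) (D : R -> Prop) (t M : R) :
  (forall s, D s -> s < t) -> (forall s s', D s -> D s' -> s <= s' -> h s <= h s') ->
  (forall s, D s -> h s <= M) ->
  exists l, filterlim h (within D (locally t)) (locally l).
Proof.
intros Hlt Hm HM.
destruct (classic (exists s, D s)) as [[s0 Ds0]|Hn].
- destruct (completeness (fun y => exists s, D s /\ y = h s)) as [L [Hub Hleast]].
  { exists M. intros y [s [Ds ->]]. apply HM; trivial. }
  { exists (h s0), s0. split; trivial. }
  exists L. apply filterlim_withinE. intros e He.
  assert (Hs1 : exists s1, D s1 /\ L - e < h s1).
  { apply NNPP. intros Hn. assert (L <= L - e); [|lra].
    apply Hleast. intros y [s [Ds ->]]. apply Rnot_lt_le. intros Hlt'.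
    apply Hn. exists s. split; trivial. }
  destruct Hs1 as [s1 [Ds1 Hs1]]. assert (H1 := Hlt s1 Ds1).
  exists (t - s1). split; [lra|]. intros s Ds Hs. apply Rabs_def2 in Hs.
  assert (H2 : h s1 <= h s) by (apply Hm; trivial; lra).
  assert (H3 : h s <= L) by (apply Hub; exists s; split; trivial).
  apply Rabs_def1; lra.
- exists 0. apply filterlim_withinE. intros e He. exists 1. split; [lra|].
  intros s Ds. exfalso. apply Hn. exists s; trivial.
Qed.

(** The increment consists of an integral over [s,s'], bounded because k(s1,.) dominates
    the kernel for earlier times, and of the variation of the kernel over [a,s]. At t = a
    the second part is empty. *)
Lemma volterra_locally_lipschitz (T : R -> Prop) (a b : R) (k : R -> R -> R) (p : R -> R) (t : R) :
  closed T -> T a -> T b -> volterra_kernel T a b k -> rd_on T a b p ->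
  (forall r, T r -> a <= r < b -> 0 <= p r) ->
  T t -> a <= t < b -> right_dense T t ->
  exists C dl, 0 < C /\ 0 < dl /\ forall s s', T s -> T s' -> a <= s <= s' -> s' < b ->
    (s = t \/ s' = t) -> Rabs (s - t) < dl -> Rabs (s' - t) < dl ->
    volterra T a k p s' - volterra T a k p s <= C * (s' - s).
Proof.
intros HT Ta Tb Hk Hp Hp0 Tt Ht Hd.
destruct (rd_on_bounded T p a b HT Ta ltac:(lra) Hp) as [P [HP Hb]].
destruct (Hd (b - t)) as [s1 [Ts1 Hs1]]; [lra|].
assert (K1 : kappa (segment T a b) s1) by (apply kappa_below; trivial; lra).
assert (Hk' := Hk). destruct Hk' as [Hkrd [Hk0 [Hkm Hkl]]].
destruct (rd_on_bounded T (k s1) a s1 HT Ta ltac:(lra) (Hkrd s1 K1 ltac:(lra))) as [N [HN Hb1]].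
assert (Hupper : forall s s', T s -> T s' -> a <= s <= s' -> a < s' <= s1 ->
   ts_int T (fun r => k s' r * p r) s s' <= N * P * (s' - s)).
{ intros s s' Ts Ts' Hs Hs'. assert (Ks' : kappa (segment T a b) s') by (apply kappa_below; trivial; lra).
  rewrite <- (ts_int_const T). apply ts_int_le; trivial; try lra.
  - apply (volterra_rd_integrand T a b); trivial; lra.
  - apply rd_on_const.
  - intros r Tr Hr. assert (Hr0 := Hp0 r Tr ltac:(lra)).
    assert (HrP := Hb r Tr ltac:(lra)). rewrite Rabs_right in HrP by lra.
    assert (HrN := Hb1 r Tr ltac:(lra)). apply Rabs_le_between in HrN.
    apply Rmult_le_compat; trivial.
    + apply Hk0; trivial; lra.
    + eapply Rle_trans; [apply (Hkm s' s1); trivial; lra|lra]. }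
assert (HNP : 0 < N * P) by (apply Rmult_lt_0_compat; trivial).
destruct (Rle_lt_or_eq_dec a t) as [Hat|Eat]; [lra| |].
- destruct (Hkl t (kappa_below T a b t Tb Tt Ht) Hat (proj2 Ht) Hd) as [M [dl [Hdl [HM HL]]]].
  assert (HMP : 0 <= M * P * (b - a)).
  { apply Rmult_le_pos; [apply Rmult_le_pos; lra|lra]. }
  exists (N * P + M * P * (b - a)), (Rmin dl (Rmin (s1 - t) (t - a))).
  assert (N1 := Rmin_l dl (Rmin (s1 - t) (t - a))). assert (N2 := Rmin_r dl (Rmin (s1 - t) (t - a))).
  assert (N3 := Rmin_l (s1 - t) (t - a)). assert (N4 := Rmin_r (s1 - t) (t - a)).
  split; [lra|split; [repeat apply Rmin_glb_lt; lra|]].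
  intros s s' Ts Ts' Hs Hs' Hor D1 D2.
  assert (D1' := Rabs_def2 _ _ D1). assert (D2' := Rabs_def2 _ _ D2).
  assert (Ks : kappa (segment T a b) s) by (apply kappa_below; trivial; lra).
  assert (Ks' : kappa (segment T a b) s') by (apply kappa_below; trivial; lra).
  unfold volterra. rewrite (ts_int_Chasles T (fun r => k s' r * p r) a s s'); trivial;
    [|apply (volterra_rd_integrand T a b); trivial; lra].
  assert (H1 := Hupper s s' Ts Ts' Hs ltac:(lra)).
  assert (H2 : ts_int T (fun r => k s' r * p r) a s
            <= ts_int T (fun r => k s r * p r + M * (s' - s) * P) a s).
  { assert (rd_on T a s (fun r => k s r * p r)) by (apply (volterra_rd_integrand T a b); trivial; lra).
    apply ts_int_le; trivial; try lra.
    - apply (volterra_rd_integrand T a b); trivial; lra.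
    - apply rd_on_plus; [trivial|apply rd_on_const].
    - intros r Tr Hr. assert (Hr0 := Hp0 r Tr ltac:(lra)).
      assert (HrP := Hb r Tr ltac:(lra)). rewrite Rabs_right in HrP by lra.
      assert (HkL : k s' r <= k s r + M * (s' - s)).
      { apply HL; trivial; lra. }
      assert (H3 : k s' r * p r <= (k s r + M * (s' - s)) * p r) by (apply Rmult_le_compat_r; trivial).
      assert (H4 : M * (s' - s) * p r <= M * (s' - s) * P).
      { apply Rmult_le_compat_l; trivial. apply Rmult_le_pos; lra. }
      lra. }
  rewrite ts_int_plus, ts_int_const in H2; trivial; try lra;
    [|apply (volterra_rd_integrand T a b); trivial; lra|apply rd_on_const].
  assert (H3 : M * (s' - s) * P * (s - a) <= M * (s' - s) * P * (b - a)).
  { apply Rmult_le_compat_l; [|lra]. apply Rmult_le_pos; [apply Rmult_le_pos; lra|lra]. }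
  lra.
- subst t. exists (N * P), (s1 - a). split; [trivial|split; [lra|]].
  intros s s' Ts Ts' Hs Hs' Hor D1 D2. apply Rabs_def2 in D2.
  assert (E : s = a) by lra. subst s. unfold volterra at 2. rewrite ts_int_point.
  destruct (Rle_lt_or_eq_dec a s') as [Has'|<-]; [lra| |].
  + unfold volterra. assert (H := Hupper a s' Ts Ts' Hs ltac:(lra)). lra.
  + unfold volterra. rewrite ts_int_point. lra.
Qed.

(** Continuity at right-dense points is the Lipschitz bound; left limits exist by
    monotonicity. *)
Lemma volterra_rd_on (T : R -> Prop) (a b : R) (k : R -> R -> R) (p : R -> R) :
  closed T -> T a -> T b -> volterra_kernel T a b k -> rd_on T a b p ->
  (forall r, T r -> a <= r < b -> 0 <= p r) -> rd_on T a b (volterra T a k p).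
Proof.
intros HT Ta Tb Hk Hp Hp0 t Tt Ht.
assert (Hincr : forall s s', kappa (segment T a b) s -> kappa (segment T a b) s' -> s <= s' ->
   volterra T a k p s <= volterra T a k p s').
{ intros s s' Ks Ks' Hss. apply (volterra_incr T a b); trivial.
  assert (Hs' := proj2 (proj1 Ks')). intros r Tr Hr. apply Hp0; trivial; lra. }
split.
- intros Htb Hd.
  destruct (volterra_locally_lipschitz T a b k p t) as [C [dl [HC [Hdl HL]]]]; trivial; try lra.
  apply filterlim_withinE. intros e He.
  assert (HeC : 0 < e / C) by (apply Rdiv_lt_0_compat; trivial).
  exists (Rmin dl (e / C)). split; [apply Rmin_glb_lt; trivial|].
  assert (N1 := Rmin_l dl (e / C)). assert (N2 := Rmin_r dl (e / C)).
  intros s [Ts Hs] Hst.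
  assert (Htt : Rabs (t - t) < dl) by (rewrite Rminus_diag, Rabs_R0; trivial).
  assert (Kt : kappa (segment T a b) t) by (apply kappa_below; trivial; lra).
  assert (Ks : kappa (segment T a b) s) by (apply kappa_below; trivial; lra).
  assert (EC : C * (e / C) = e) by (field; lra).
  assert (Hst' := Rabs_def2 _ _ Hst).
  destruct (Rle_lt_dec s t) as [Hle|Hlt].
  + assert (H1 := HL s t Ts Tt ltac:(lra) ltac:(lra) (or_intror eq_refl) ltac:(lra) Htt).
    assert (H2 := Hincr s t Ks Kt Hle).
    assert (C * (t - s) < C * (e / C)) by (apply Rmult_lt_compat_l; lra).
    apply Rabs_def1; lra.
  + assert (H1 := HL t s Tt Ts ltac:(lra) ltac:(lra) (or_introl eq_refl) Htt ltac:(lra)).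
    assert (H2 := Hincr t s Kt Ks ltac:(lra)).
    assert (C * (s - t) < C * (e / C)) by (apply Rmult_lt_compat_l; lra).
    apply Rabs_def1; lra.
- destruct (kappa_or_left_scattered T a b t) as [Kt|Hns]; trivial.
  + apply (monotone_left_limit _ _ t (volterra T a k p t)).
    * intros s Hs. lra.
    * intros s s' [Ts Hs] [Ts' Hs'] Hss. apply Hincr; trivial; apply kappa_below; trivial; lra.
    * intros s [Ts Hs]. apply Hincr; trivial; [apply kappa_below; trivial|]; lra.
  + destruct (not_left_dense T t Hns) as [g [Hg Hgap]].
    exists 0. apply filterlim_withinE. intros e He. exists g. split; trivial.
    intros s [Ts Hs] Hst. apply Rabs_def2 in Hst. assert (H := Hgap s Ts ltac:(lra)). lra.
Qed.

Lemma ts_int_primitive_rd_on (T : R -> Prop) (a b : R) (p : R -> R) :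
  closed T -> T a -> T b -> rd_on T a b p ->
  (forall r, T r -> a <= r < b -> 0 <= p r) -> rd_on T a b (ts_int T p a).
Proof.
intros HT Ta Tb Hp Hp0. apply (rd_on_ext T a b (volterra T a (fun _ _ => 1) p)).
- intros s Ts Hs. apply ts_int_ext; trivial; try lra. intros; ring.
- apply volterra_rd_on; trivial. apply volterra_kernel_one.
Qed.

Lemma rd_continuous_segment (T : R -> Prop) (a b : R) (h : R -> R) :
  T b -> a <= b -> rd_continuous T (segment T a b) h -> rd_on T a b h.
Proof.
intros Tb Hab H. apply (rd_continuous_rd_on T T (segment T a b)); trivial.
- intros s Ts Hs. repeat split; trivial; lra.
- left. repeat split; trivial; lra.
- intros s Ts Hs Hd e He. destruct (Hd e He) as [r [Tr [_ Hr]]]. exists r; split; trivial.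
Qed.

Lemma rd_continuous_kappa (T : R -> Prop) (a b : R) (h : R -> R) :
  T a -> T b -> a <= b -> rd_continuous T (kappa (segment T a b)) h -> rd_on T a b h.
Proof.
intros Ta Tb Hab H. apply (rd_continuous_rd_on T T (kappa (segment T a b))); trivial.
- intros s Ts Hs. apply kappa_below; trivial.
- apply kappa_or_left_scattered; trivial; lra.
- intros s Ts Hs Hd e He. destruct (Hd e He) as [r [Tr [_ Hr]]]. exists r; split; trivial.
Qed.

Lemma rd_on_gauge (T : R -> Prop) (c d : R) (phi h : R -> R) :
  gauge phi -> (forall s, T s -> c <= s < d -> 0 <= h s) ->
  rd_on T c d h -> rd_on T c d (fun s => phi (h s)).
Proof.
intros G H0 H. apply (rd_on_ext T c d (fun s => phi (Rmax 0 (h s)))).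
- intros s Ts Hs. rewrite Rmax_right; trivial. apply H0; trivial.
- apply (rd_on_comp T c d h (fun y => phi (Rmax 0 y))); trivial.
  intros x. apply gauge_continuous_clip; trivial.
Qed.

Lemma Delta_int_volterra (T : R -> Prop) (a b : R) (k : R -> R -> R) (p h : R -> R) (s : R) :
  closed T -> T a -> volterra_kernel T a b k -> rd_on T a b p -> kappa (segment T a b) s ->
  (forall r, T r -> a <= r < s -> h r = k s r * p r) ->
  Delta_int T h a s = volterra T a k p s.
Proof.
intros HT Ta Hk Hp Ks E. assert (Hs := proj2 (proj1 Ks)).
destruct (Rle_lt_or_eq_dec a s) as [Has|<-]; [lra| |].
- apply Delta_int_ts_int; trivial; try lra.
  + exact (proj1 (proj1 Ks)).
  + apply (volterra_rd_integrand T a b); trivial; lra.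
- unfold volterra. rewrite ts_int_point, <- (ts_int_point T (fun _ => 0) a).
  apply Delta_int_ts_int; trivial; try lra; [apply rd_on_const|intros; lra].
Qed.

(** * The two integral inequalities *)

(** The class S inequality gives g(u)/m <= g(u/m), so v = u/m satisfies v <= z with
    z = 1 + integral of f g(v), whose increments are at most g(B) times those of the
    primitive of f. *)
Lemma class_S_gronwall (T : R -> Prop) (f u g : R -> R) (x0 m a t : R) :
  closed T -> T a -> T t -> a <= t -> class_S g -> 0 < x0 -> 1 <= m ->
  rd_on T a t f -> (forall s, T s -> a <= s < t -> 0 <= f s) ->
  rd_on T a t u -> (forall s, T s -> a <= s <= t -> 0 <= u s) ->
  (forall s, T s -> a <= s <= t -> u s <= m + ts_int T (fun r => f r * g (u r)) a s) ->
  u t <= m * inv_fun (recip_int g x0) (recip_int g x0 1 + ts_int T f a t).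
Proof.
intros HT Ta Tt Hat HgS Hx0 Hm Hf Hf0 Hu Hu0 Hle.
destruct HgS as [Gg HS]. assert (HgS : class_S g) by (split; trivial).
assert (Hm0 : 0 < m) by lra. assert (Him : 0 < / m) by (apply Rinv_0_lt_compat; trivial).
assert (Gg0 := proj1 (proj2 Gg)). assert (Ggi := proj1 (proj2 (proj2 Gg))).
set (v := fun s => u s / m).
assert (Hv0 : forall s, T s -> a <= s <= t -> 0 <= v s).
{ intros s Ts Hs. apply Rmult_le_pos; [apply Hu0; trivial|lra]. }
assert (Hv : rd_on T a t v) by (apply rd_on_mult; [trivial|apply rd_on_const]).
assert (Hgv : rd_on T a t (fun s => g (v s))).
{ apply rd_on_gauge; trivial. intros; apply Hv0; trivial; lra. }
assert (Hgu : rd_on T a t (fun s => g (u s))).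
{ apply rd_on_gauge; trivial. intros; apply Hu0; trivial; lra. }
set (w := fun s => f s * g (v s)).
assert (Hw : rd_on T a t w) by (apply rd_on_mult; trivial).
assert (Hw0 : forall s, T s -> a <= s < t -> 0 <= w s).
{ intros s Ts Hs. apply Rmult_le_pos; [apply Hf0; trivial|apply Gg0, Hv0; trivial; lra]. }
set (z := fun s => 1 + ts_int T w a s).
assert (Hz1 : forall s, T s -> a <= s <= t -> 1 <= z s).
{ intros s Ts Hs. assert (0 <= ts_int T w a s); [|unfold z; lra].
  apply ts_int_ge0; trivial; try lra; [apply (rd_on_sub T a t); trivial; lra|].
  intros; apply Hw0; trivial; lra. }
assert (Hzd : forall s s', T s -> T s' -> a <= s <= s' -> s' <= t -> z s' - z s = ts_int T w s s').
{ intros s s' Ts Ts' Hs Hs'. unfold z. rewrite (ts_int_Chasles T w a s s'); trivial; try lra.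
  apply (rd_on_sub T a t); trivial; lra. }
assert (Hvz : forall s, T s -> a <= s <= t -> v s <= z s).
{ intros s Ts Hs.
  assert (Hfg : rd_on T a s (fun r => f r * g (u r))).
  { apply (rd_on_sub T a t); try lra. apply rd_on_mult; trivial. }
  assert (H1 : ts_int T (fun r => / m * (f r * g (u r))) a s <= ts_int T w a s).
  { apply ts_int_le; trivial; try lra.
    - apply rd_on_mult; trivial. apply rd_on_const.
    - apply (rd_on_sub T a t); trivial; lra.
    - intros r Tr Hr. unfold w.
      assert (H := HS (u r) m (Hu0 r Tr ltac:(lra)) Hm).
      replace (/ m * (f r * g (u r))) with (f r * (1 / m * g (u r))) by (field; lra).
      apply Rmult_le_compat_l; [apply Hf0; trivial; lra|exact H]. }
  rewrite ts_int_scal in H1 by (trivial; lra).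
  assert (H2 := Hle s Ts Hs). apply (Rmult_le_compat_l (/ m)) in H2; [|lra].
  rewrite Rmult_plus_distr_l, Rinv_l in H2 by lra. unfold v, z, Rdiv. lra. }
assert (Hmono : forall s s', T s -> T s' -> a <= s <= s' -> s' <= t -> z s <= z s').
{ intros s s' Ts Ts' Hs Hs'. assert (H := Hzd s s' Ts Ts' Hs Hs').
  assert (0 <= ts_int T w s s'); [|lra].
  apply ts_int_ge0; trivial; try lra; [apply (rd_on_sub T a t); trivial; lra|].
  intros; apply Hw0; trivial; lra. }
assert (HB : recip_int g x0 (z t) - recip_int g x0 (z a) <= ts_int T f a t - ts_int T f a a).
{ apply (bihari_comparison T g z (ts_int T f a) x0 a t); trivial.
  - intros s Ts Hs. assert (H := Hz1 s Ts Hs). lra.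
  - apply rd_on_plus; [apply rd_on_const|]. apply ts_int_primitive_rd_on; trivial.
  - intros s s' B Ts Ts' Hs Hs' Hb. rewrite Hzd by (trivial; lra).
    rewrite (ts_int_Chasles T f a s s'); trivial; try lra;
      [|apply (rd_on_sub T a t); trivial; lra].
    replace (ts_int T f a s + ts_int T f s s' - ts_int T f a s) with (ts_int T f s s') by ring.
    assert (Hf' : rd_on T s s' f) by (apply (rd_on_sub T a t); trivial; lra).
    rewrite <- ts_int_scal by (trivial; lra).
    apply ts_int_le; trivial; try lra.
    + apply (rd_on_sub T a t); trivial; lra.
    + apply rd_on_mult; trivial. apply rd_on_const.
    + intros r Tr Hr. unfold w. rewrite Rmult_comm.
      apply Rmult_le_compat_r; [apply Hf0; trivial; lra|].
      apply Ggi; [apply Hv0; trivial; lra|].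
      apply (Rle_trans _ (z r)); [apply Hvz; trivial; lra|apply Hb; trivial]. }
assert (Eza : z a = 1) by (unfold z; rewrite ts_int_point; ring).
rewrite Eza, ts_int_point in HB.
assert (HF0 : 0 <= ts_int T f a t) by (apply ts_int_ge0; trivial).
destruct (inv_fun_spec _ _ (class_S_dom_inv g x0 _ HgS Hx0 HF0)) as [Hq0 Hq].
set (q := inv_fun (recip_int g x0) (recip_int g x0 1 + ts_int T f a t)) in *.
assert (Hz1t := Hz1 t Tt ltac:(lra)).
assert (Hzq : z t <= q) by (apply (recip_int_le_inv g x0); trivial; lra).
assert (Hvt := Hvz t Tt ltac:(lra)).
replace (u t) with (m * v t) by (unfold v; field; lra).
apply Rmult_le_compat_l; lra.
Qed.

(** R1 = z + integral of k h phi(w) dominates w, so on [a,s') its integrand is at most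
    phi(B) k h, and [volterra_increment_le] gives the increment hypothesis of
    [bihari_comparison]. *)
Lemma volterra_bihari (T : R -> Prop) (a b : R) (k : R -> R -> R) (phi h w : R -> R) (x0 z s : R) :
  closed T -> T a -> T b -> volterra_kernel T a b k -> gauge phi -> 0 < x0 -> 0 < z ->
  rd_on T a b h -> (forall r, T r -> a <= r < b -> 0 <= h r) ->
  rd_on T a b w -> (forall r, T r -> a <= r < b -> 0 <= w r) ->
  (forall r, kappa (segment T a b) r -> w r <= z + volterra T a k (fun x => h x * phi (w x)) r) ->
  kappa (segment T a b) s ->
  dom_inv (recip_int phi x0) (recip_int phi x0 z + volterra T a k h s) ->
  w s <= inv_fun (recip_int phi x0) (recip_int phi x0 z + volterra T a k h s).
Proof.
intros HT Ta Tb Hk G Hx0 Hz Hh Hh0 Hw Hw0 Hle Ks Hdom.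
assert (Hs := proj2 (proj1 Ks)). assert (Ts := proj1 (proj1 Ks)).
assert (G0 := proj1 (proj2 G)). assert (Gi := proj1 (proj2 (proj2 G))).
set (p := fun x => h x * phi (w x)) in *.
assert (Hp : rd_on T a b p) by (apply rd_on_mult; trivial; apply rd_on_gauge; trivial).
assert (Hp0 : forall r, T r -> a <= r < b -> 0 <= p r).
{ intros r Tr Hr. apply Rmult_le_pos; [apply Hh0; trivial|apply G0, Hw0; trivial]. }
set (R1 := fun r => z + volterra T a k p r).
assert (HK : forall r, T r -> a <= r <= s -> kappa (segment T a b) r).
{ intros r Tr Hr. destruct (Rle_lt_or_eq_dec r s) as [Hlt| ->]; [lra| |trivial].
  apply kappa_below; trivial; lra. }
assert (Hmono : forall r r', T r -> T r' -> a <= r <= r' -> r' <= s -> R1 r <= R1 r').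
{ intros r r' Tr Tr' Hr Hr'. apply Rplus_le_compat_l. apply (volterra_incr T a b); trivial; try lra.
  - apply HK; trivial; lra.
  - apply HK; trivial; lra.
  - intros x Tx Hx. apply Hp0; trivial; lra. }
assert (HR1 : forall r, T r -> a <= r <= s -> 0 < R1 r).
{ intros r Tr Hr. assert (0 <= volterra T a k p r); [|unfold R1; lra].
  apply (volterra_ge0 T a b); trivial; [apply HK; trivial|].
  intros x Tx Hx. apply Hp0; trivial; lra. }
assert (HB : recip_int phi x0 (R1 s) - recip_int phi x0 (R1 a)
          <= volterra T a k h s - volterra T a k h a).
{ apply (bihari_comparison T phi R1 (volterra T a k h) x0 a s); trivial; try lra.
  - apply rd_on_plus; [apply rd_on_const|]. apply (rd_on_sub T a b); try lra.
    apply volterra_rd_on; trivial.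
  - intros r r' B Tr Tr' Hr Hr' Hb.
    replace (R1 r' - R1 r) with (volterra T a k p r' - volterra T a k p r) by (unfold R1; ring).
    apply (volterra_increment_le T a b); trivial; try (apply HK; trivial; lra); try lra.
    intros x Tx Hx. unfold p. rewrite Rmult_comm.
    apply Rmult_le_compat_r; [apply Hh0; trivial; lra|].
    apply Gi; [apply Hw0; trivial; lra|].
    eapply Rle_trans; [apply Hle, HK; trivial; lra|]. fold (R1 x).
    destruct (Rle_lt_dec r x) as [Hrx|Hrx]; [apply Hb; trivial; lra|].
    apply (Rle_trans _ (R1 r)); [apply Hmono; trivial; lra|apply Hb; trivial; lra]. }
assert (Ea : R1 a = z) by (unfold R1, volterra; rewrite ts_int_point; ring).
unfold volterra at 2 in HB. rewrite Ea, ts_int_point in HB.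
destruct (inv_fun_spec _ _ Hdom) as [Hi0 Hi].
eapply Rle_trans; [apply Hle; trivial|]. fold (R1 s).
apply (recip_int_le_inv phi x0); trivial; [apply HR1; trivial; lra|lra].
Qed.

(** * The estimate *)

Theorem theorem95 :
  forall (T : R -> Prop) (a b : R) (u f al : R -> R) (k : R -> R -> R)
         (Phi W g : R -> R) (x0 delta : R),
  time_scale T -> T a -> T b -> a <= b ->
  let Ts := segment T a b in
  (forall t, Ts t -> 0 <= u t) -> rd_continuous T Ts u ->
  (forall t, kappa Ts t -> 0 <= f t) -> rd_continuous T (kappa Ts) f ->
  condition_K Ts a k ->
  (forall t s, Ts t -> Ts s -> s <= t -> 0 <= k t s) ->
  (forall t s, kappa Ts t -> Ts s -> s <= t ->
     ex_delta_derive Ts (fun r => k r s) t ->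
     0 <= Delta_derive Ts (fun r => k r s) t) ->
  (exists t s, kappa Ts t /\ kappa (kappa Ts) s /\ k t s <> 0) ->
  gauge Phi -> subadditive Phi -> submultiplicative Phi ->
  gauge W ->
  class_S g ->
  (forall t, Ts t -> 0 < al t) -> rd_continuous T Ts al ->
  (forall s t, Ts s -> Ts t -> s <= t -> al s <= al t) ->
  0 < x0 -> 0 < delta ->
  (forall t, Ts t ->
     u t <= al t
            + Delta_int T (fun s => f s * g (u s)) a t
            + Delta_int T (fun s => f s *
                W (Delta_int T (fun tau => k s tau * Phi (u tau)) a s)) a t) ->
  let Psi := fun x => RInt (fun s => 1 / Phi (W s)) x0 x in
  let G := fun x => RInt (fun s => 1 / g s) delta x in
  let q := fun t => inv_fun G (G 1 + Delta_int T f a t) in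
  let zeta := Delta_int T
    (fun s => k (rho Ts b) s * Phi (q s * Rmax (al s) 1)) a (rho Ts b) in
  let E := fun s => Delta_int T
    (fun tau => k s tau * Phi (q tau) * Phi (Delta_int T f a tau)) a s in
  forall t, Ts t ->
  dom_inv G (G 1 + Delta_int T f a t) ->
  (* Psi is a function on (0, oo): Psi zeta is meaningful for 0 < zeta *)
  0 < zeta /\ dom_inv Psi (Psi zeta + E (rho Ts t)) ->
  u t <= q t * Rmax (al t) 1
         + q t * Delta_int T (fun s => f s * W (inv_fun Psi (Psi zeta + E s))) a t.
Proof.
intros T a b u f al k Phi W g x0 delta [_ HT] Ta Tb Hab Ts Hu0 Hu Hf0 Hf HK Hk0 Hk1 _
  GPhi Hsub Hmul GW HgS Hal0 Hal Halm Hx0 Hdelta Hmain Psi G q zeta E t [Tt Ht] _ [Hzeta Hdom].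
change (fun x => RInt (fun s => 1 / Phi (W s)) x0 x)
  with (recip_int (fun s => Phi (W s)) x0) in Psi.
change (fun x => RInt (fun s => 1 / g s) delta x) with (recip_int g delta) in G.
assert (Hk := condition_K_volterra_kernel T a b k HT Ta Tb HK Hk0 Hk1).
assert (Hrdu := rd_continuous_segment T a b u Tb Hab Hu).
assert (Hrdal := rd_continuous_segment T a b al Tb Hab Hal).
assert (Hrdf := rd_continuous_kappa T a b f Ta Tb Hab Hf).
assert (Kb : forall s, T s -> a <= s < b -> kappa Ts s) by (intros; apply kappa_below; trivial).
assert (GPW := gauge_comp Phi W GPhi GW).
assert (P0 := proj1 (proj2 GPhi)). assert (Pi := proj1 (proj2 (proj2 GPhi))).
assert (W0 := proj1 (proj2 GW)). assert (Wi := proj1 (proj2 (proj2 GW))).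
assert (Hf0' : forall s, T s -> a <= s < b -> 0 <= f s) by (intros; apply Hf0, Kb; trivial).
assert (Hu0' : forall s, T s -> a <= s <= b -> 0 <= u s) by (intros; apply Hu0; split; trivial).
set (F := ts_int T f a).
assert (HF : forall s, T s -> a <= s <= b -> Delta_int T f a s = F s).
{ intros s Tss Hs. apply Delta_int_ts_int; trivial; try lra.
  apply (rd_on_sub T a b); trivial; lra. }
assert (HrdF : rd_on T a b F) by (apply ts_int_primitive_rd_on; trivial).
assert (HFsplit : forall s s', T s -> T s' -> a <= s <= s' -> s' <= b -> F s <= F s').
{ intros s s' Tss Tss' Hs Hs'. unfold F. rewrite (ts_int_Chasles T f a s s'); trivial; try lra.
  - assert (0 <= ts_int T f s s'); [|lra].
    apply ts_int_ge0; trivial; try lra; [apply (rd_on_sub T a b); trivial; lra|].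
    intros; apply Hf0'; trivial; lra.
  - apply (rd_on_sub T a b); trivial; lra. }
assert (HFa : F a = 0) by apply ts_int_point.
assert (HF0 : forall s, T s -> a <= s <= b -> 0 <= F s).
{ intros s Tss Hs. rewrite <- HFa. apply HFsplit; trivial; lra. }
set (Q := fun s => inv_fun G (G 1 + F s)).
assert (HqQ : forall s, T s -> a <= s <= b -> q s = Q s).
{ intros s Tss Hs. unfold q, Q. now rewrite HF. }
assert (HGdom : forall y, 0 <= y -> dom_inv G (G 1 + y)).
{ intros y Hy. apply class_S_dom_inv; trivial. }
assert (HQ0 : forall s, T s -> a <= s <= b -> 0 < Q s).
{ intros s Tss Hs. apply (inv_fun_spec G), HGdom, HF0; trivial. }
assert (HrdQ : rd_on T a b Q).
{ destruct (inv_fun_continuous_extension g delta (G 1) (G 1 + F b)) as [p [Hpc Hp]]; trivial.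
  - apply HgS.
  - assert (H := HF0 b Tb ltac:(lra)). lra.
  - exists 1. split; [lra|reflexivity].
  - apply HGdom, HF0; trivial; lra.
  - apply (rd_on_ext T a b (fun s => p (G 1 + F s))).
    + intros s Tss Hs. apply Hp. assert (H := HF0 s Tss ltac:(lra)).
      assert (H' := HFsplit s b Tss Tb ltac:(lra) ltac:(lra)). lra.
    + apply (rd_on_comp T a b (fun s => G 1 + F s) p); trivial.
      apply rd_on_plus; [apply rd_on_const|trivial]. }
set (Pu := fun s => Phi (u s)).
assert (HrdPu : rd_on T a b Pu).
{ apply (rd_on_gauge T a b Phi u); trivial. intros; apply Hu0'; trivial; lra. }
assert (HPu0 : forall s, T s -> a <= s < b -> 0 <= Pu s).
{ intros s Tss Hs. apply P0, Hu0'; trivial; lra. }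
set (V := volterra T a k Pu).
assert (HV : forall s, kappa Ts s -> Delta_int T (fun tau => k s tau * Phi (u tau)) a s = V s).
{ intros s Ks. apply (Delta_int_volterra T a b); trivial. }
assert (HrdV : rd_on T a b V) by (apply volterra_rd_on; trivial).
assert (HV0 : forall s, kappa Ts s -> 0 <= V s).
{ intros s Ks. apply (volterra_ge0 T a b); trivial. assert (H := proj2 (proj1 Ks)).
  intros; apply HPu0; trivial; lra. }
assert (HVm : forall s s', kappa Ts s -> kappa Ts s' -> s <= s' -> V s <= V s').
{ intros s s' Ks Ks' Hss. apply (volterra_incr T a b); trivial. assert (H := proj2 (proj1 Ks')).
  intros; apply HPu0; trivial; lra. }
set (fWV := fun s => f s * W (V s)).
assert (HrdfWV : rd_on T a b fWV).
{ apply rd_on_mult; trivial. apply (rd_on_gauge T a b W V); trivial.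
  intros; apply HV0, Kb; trivial. }
assert (HfWV0 : forall s, T s -> a <= s < b -> 0 <= fWV s).
{ intros s Tss Hs. apply Rmult_le_pos; [apply Hf0'; trivial|apply W0, HV0, Kb; trivial]. }
set (X := ts_int T fWV a).
assert (HX : forall s s', T s -> T s' -> a <= s <= s' -> s' <= b -> X s <= X s').
{ intros s s' Tss Tss' Hs Hs'. unfold X. rewrite (ts_int_Chasles T fWV a s s'); trivial; try lra.
  - assert (0 <= ts_int T fWV s s'); [|lra].
    apply ts_int_ge0; trivial; try lra; [apply (rd_on_sub T a b); trivial; lra|].
    intros; apply HfWV0; trivial; lra.
  - apply (rd_on_sub T a b); trivial; lra. }
assert (HX0 : forall s, T s -> a <= s <= b -> 0 <= X s).
{ intros s Tss Hs. rewrite <- (ts_int_point T fWV a). apply HX; trivial; lra. }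
assert (Gg := proj1 HgS).
assert (Hrdgu : rd_on T a b (fun s => f s * g (u s))).
{ apply rd_on_mult; trivial. apply (rd_on_gauge T a b g u); trivial.
  intros; apply Hu0'; trivial; lra. }
assert (Hmain' : forall s, T s -> a <= s <= b ->
   u s <= al s + ts_int T (fun r => f r * g (u r)) a s + X s).
{ intros s Tss Hs. assert (H := Hmain s (conj Tss Hs)).
  rewrite (Delta_int_ts_int T _ (fun r => f r * g (u r)) a s) in H; trivial; try lra;
    [|apply (rd_on_sub T a b); trivial; lra].
  rewrite (Delta_int_ts_int T _ fWV a s) in H; trivial; try lra.
  - apply (rd_on_sub T a b); trivial; lra.
  - intros r Tr Hr. unfold fWV. rewrite HV by (apply Kb; trivial; lra). reflexivity. }
(* The forcing term al + X is nondecreasing, so on [a,s] it may be frozen at s. *)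
assert (Hstep1 : forall s, T s -> a <= s <= b -> u s <= Q s * (Rmax (al s) 1 + X s)).
{ intros s Tss Hs. set (m := Rmax (al s) 1 + X s).
  assert (HXs := HX0 s Tss Hs). assert (M1 := Rmax_l (al s) 1). assert (M2 := Rmax_r (al s) 1).
  rewrite Rmult_comm.
  apply (class_S_gronwall T f u g delta m a s); trivial; try lra.
  - unfold m; lra.
  - apply (rd_on_sub T a b); trivial; lra.
  - intros; apply Hf0'; trivial; lra.
  - apply (rd_on_sub T a b); trivial; lra.
  - intros; apply Hu0'; trivial; lra.
  - intros r Tr Hr. eapply Rle_trans; [apply Hmain'; trivial; lra|].
    assert (A1 : al r <= al s) by (apply Halm; try split; trivial; lra).
    assert (A2 := HX r s Tr Tss ltac:(lra) ltac:(lra)). unfold m; lra. }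
(* Inserting this bound of u in V gives a Volterra inequality for V with
   nonlinearity Phi o W, kernel k h and forcing term the integral of k c0. *)
set (h := fun s => Phi (Q s) * Phi (F s)).
set (c0 := fun s => Phi (Q s * Rmax (al s) 1)).
assert (HQm0 : forall s, T s -> a <= s <= b -> 0 <= Q s * Rmax (al s) 1).
{ intros s Tss Hs. assert (H := HQ0 s Tss Hs). assert (M2 := Rmax_r (al s) 1).
  apply Rmult_le_pos; lra. }
assert (Hrdh : rd_on T a b h).
{ apply rd_on_mult.
  - apply (rd_on_gauge T a b Phi Q); trivial. intros; left; apply HQ0; trivial; lra.
  - apply (rd_on_gauge T a b Phi F); trivial. intros; apply HF0; trivial; lra. }
assert (Hh0 : forall s, T s -> a <= s < b -> 0 <= h s).
{ intros s Tss Hs. apply Rmult_le_pos; apply P0; [left; apply HQ0|apply HF0]; trivial; lra. }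
assert (Hrdc : rd_on T a b c0).
{ apply (rd_on_gauge T a b Phi (fun s => Q s * Rmax (al s) 1)); trivial;
    [intros; apply HQm0; trivial; lra|].
  apply rd_on_mult; trivial. apply (rd_on_ext T a b (fun s => Rmax 1 (al s))).
  - intros. apply Rmax_comm.
  - apply (rd_on_comp T a b al (fun y => Rmax 1 y)); trivial.
    intros; apply continuous_Rmax_const. }
assert (Hc0 : forall s, T s -> a <= s < b -> 0 <= c0 s).
{ intros s Tss Hs. apply P0, HQm0; trivial; lra. }
destruct (kappa_rho T a b b) as [Krb _]; trivial; try lra. fold Ts in Krb.
assert (Hzc : zeta = volterra T a k c0 (rho Ts b)).
{ apply (Delta_int_volterra T a b); trivial. intros r Tr Hr.
  assert (H := proj2 (proj1 Krb)). unfold c0. rewrite HqQ by (trivial; lra). reflexivity. }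
assert (HE : forall s, kappa Ts s -> E s = volterra T a k h s).
{ intros s Ks. apply (Delta_int_volterra T a b); trivial. intros r Tr Hr.
  assert (H := proj2 (proj1 Ks)). unfold h.
  rewrite HqQ, HF by (trivial; lra). ring. }
assert (HXV : forall s, kappa Ts s -> X s <= F s * W (V s)).
{ intros s Ks. destruct (proj1 Ks) as [Tss Hs].
  assert (Hf' : rd_on T a s f) by (apply (rd_on_sub T a b); trivial; lra).
  unfold X, F. rewrite Rmult_comm, <- ts_int_scal by (trivial; lra).
  apply ts_int_le; trivial; try lra.
  - apply (rd_on_sub T a b); trivial; lra.
  - apply rd_on_mult; trivial. apply rd_on_const.
  - intros r Tr Hr. unfold fWV. rewrite Rmult_comm.
    assert (Kr : kappa Ts r) by (apply Kb; trivial; lra).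
    apply Rmult_le_compat_r; [apply Hf0; trivial|].
    apply Wi; [apply HV0|apply HVm]; trivial; lra. }
assert (Hpoint : forall s, kappa Ts s -> Pu s <= c0 s + h s * Phi (W (V s))).
{ intros s Ks. destruct (proj1 Ks) as [Tss Hs]. unfold Pu, c0, h.
  assert (H1 := Hstep1 s Tss Hs). assert (H2 := HXV s Ks). assert (H3 := HQ0 s Tss Hs).
  assert (H4 := HF0 s Tss Hs). assert (H5 := W0 _ (HV0 s Ks)).
  assert (H6 : 0 <= F s * W (V s)) by (apply Rmult_le_pos; trivial).
  assert (H7 : Q s * X s <= Q s * (F s * W (V s))) by (apply Rmult_le_compat_l; lra).
  apply (Rle_trans _ (Phi (Q s * Rmax (al s) 1 + Q s * (F s * W (V s))))).
  { apply Pi; [apply Hu0'; trivial|lra]. }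
  eapply Rle_trans; [apply Hsub; [apply HQm0; trivial|apply Rmult_le_pos; lra]|].
  apply Rplus_le_compat_l.
  eapply Rle_trans; [apply Hmul; lra|]. rewrite Rmult_assoc.
  apply Rmult_le_compat_l; [apply P0; lra|]. apply Hmul; trivial. }
set (hV := fun s => h s * Phi (W (V s))).
assert (HrdhV : rd_on T a b hV).
{ apply rd_on_mult; trivial. apply (rd_on_gauge T a b (fun s => Phi (W s)) V); trivial.
  intros; apply HV0, Kb; trivial. }
assert (HVle : forall s, kappa Ts s -> V s <= zeta + volterra T a k hV s).
{ intros s Ks. assert (Hs := proj2 (proj1 Ks)).
  assert (Ka : kappa Ts a) by (apply kappa_left; trivial).
  assert (H := volterra_increment_le T a b k Pu (fun r => 1 * c0 r + 1 * hV r) 1 a s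
     HT Ta Hk HrdPu).
  rewrite !(volterra_lincomb T a b) in H by trivial.
  unfold volterra at 2 5 6 in H. rewrite !ts_int_point in H.
  assert (H' : V s <= volterra T a k c0 s + volterra T a k hV s).
  { unfold V. enough (volterra T a k Pu s - 0 <=
      1 * (1 * volterra T a k c0 s + 1 * volterra T a k hV s - (1 * 0 + 1 * 0))) by lra.
    apply H; trivial; try lra.
    - apply rd_on_plus; apply rd_on_mult; trivial; apply rd_on_const.
    - intros r Tr Hr. assert (Hp := Hpoint r (Kb r Tr ltac:(lra))). unfold hV. lra. }
  assert (Hz : volterra T a k c0 s <= zeta).
  { rewrite Hzc. assert (Hrb := proj2 (proj1 Krb)).
    apply (volterra_incr T a b); trivial.
    - apply kappa_le_rho; trivial.
    - intros; apply Hc0; trivial; lra. }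
  lra. }
(* Points s < t satisfy s <= rho t and E is nondecreasing, so the hypothesis at rho t
   puts Psi zeta + E s in the domain of the inverse of Psi. *)
destruct (kappa_rho T a b t) as [Krt Hrt]; trivial. fold Ts in Krt, Hrt.
rewrite (HE _ Krt) in Hdom.
assert (Hzdom : dom_inv Psi (Psi zeta)) by (exists zeta; split; trivial).
assert (HErange : forall s, T s -> a <= s < t ->
   0 <= volterra T a k h s <= volterra T a k h (rho Ts t)).
{ intros s Tss Hs. assert (Ks : kappa Ts s) by (apply Kb; trivial; lra).
  assert (Hr := proj2 (proj1 Krt)). split.
  - apply (volterra_ge0 T a b); trivial. intros; apply Hh0; trivial; lra.
  - apply (volterra_incr T a b); trivial; [apply Hrt; trivial|].
    intros; apply Hh0; trivial; lra. }
assert (HEdom : forall s, T s -> a <= s < t -> dom_inv Psi (Psi zeta + volterra T a k h s)).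
{ intros s Tss Hs. assert (H := HErange s Tss Hs).
  apply (dom_inv_between (fun s => Phi (W s)) x0 (Psi zeta)
           (Psi zeta + volterra T a k h (rho Ts t))); trivial; lra. }
set (Y := fun s => inv_fun Psi (Psi zeta + volterra T a k h s)).
assert (HVY : forall s, T s -> a <= s < t -> V s <= Y s).
{ intros s Tss Hs. apply (volterra_bihari T a b); trivial.
  - intros; apply HV0, Kb; trivial.
  - apply Kb; trivial; lra.
  - apply HEdom; trivial. }
assert (HrdY : rd_on T a t Y).
{ assert (Hr0 : 0 <= volterra T a k h (rho Ts t)).
  { apply (volterra_ge0 T a b); trivial. assert (Hr := proj2 (proj1 Krt)).
    intros; apply Hh0; trivial; lra. }
  destruct (inv_fun_continuous_extension (fun s => Phi (W s)) x0 (Psi zeta)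
     (Psi zeta + volterra T a k h (rho Ts t))) as [p [Hpc Hp]]; trivial; try lra.
  apply (rd_on_ext T a t (fun s => p (Psi zeta + volterra T a k h s))).
  - intros s Tss Hs. apply Hp. assert (H := HErange s Tss Hs). lra.
  - apply (rd_on_comp T a t (fun s => Psi zeta + volterra T a k h s) p); trivial.
    apply rd_on_plus; [apply rd_on_const|]. apply (rd_on_sub T a b); try lra.
    apply volterra_rd_on; trivial. }
assert (HrdfY : rd_on T a t (fun s => f s * W (Y s))).
{ apply rd_on_mult; [apply (rd_on_sub T a b); trivial; lra|].
  apply (rd_on_gauge T a t W Y); trivial. intros s Tss Hs.
  left. apply (inv_fun_spec Psi), HEdom; trivial. }
rewrite (Delta_int_ts_int T _ (fun s => f s * W (Y s)) a t); trivial; try lra.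
2:{ intros s Tss Hs. unfold Y. rewrite HE by (apply Kb; trivial; lra). reflexivity. }
rewrite HqQ by trivial.
assert (HXY : X t <= ts_int T (fun s => f s * W (Y s)) a t).
{ apply ts_int_le; trivial; try lra.
  - apply (rd_on_sub T a b); trivial; lra.
  - intros s Tss Hs. apply Rmult_le_compat_l; [apply Hf0'; trivial; lra|].
    apply Wi; [apply HV0, Kb; trivial; lra|apply HVY; trivial]. }
eapply Rle_trans; [apply Hstep1; trivial|].
rewrite Rmult_plus_distr_l. apply Rplus_le_compat_l.
apply Rmult_le_compat_l; trivial. left. apply HQ0; trivial.
Qed.
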